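(* Let $K$ be a field of characteristic $0$, let $P=K[x_1,\dots,x_n]$, and let $I\subseteq P$ be a homogeneous ideal generated in degree $\le\delta+1$, where $\delta\in\mathbb{N}$, such that $I_\delta\ne P_\delta$. Let $i=\min\{j\in\{1,\dots,n\}\mid \mathcal{M}_{P/I}(j,\delta)\ne 0\}$. If $\mathcal{M}_{P/I}(i,\delta)=\mathcal{M}_{P/I}(i,\delta+1)$, then $$\dim(P/I)=n-i+1\quad\text{and}\quad \deg(P/I)=\mathcal{M}_{P/I}(i,\delta).$$
   Context: $P$ has the standard grading. For a homogeneous ideal $I\subseteq P$, the sectional matrix of $P/I$ is the function $\mathcal{M}_{P/I}:\{1,\dots,n\}\times\mathbb{N}\to\mathbb{N}$, $\mathcal{M}_{P/I}(i,d)=\dim_K\big(P_d/(I+(L_1,\dots,L_{n-i}))_d\big)$, where $L_1,\dots,L_{n-i}$ are generic linear forms (the value is the same for all choices of coefficients in a suitable non-empty Zariski-open set). Here $\dim(P/I)$ is the Krull dimension and $\deg(P/I)$ is the multiplicity of $P/I$, i.e. the value at $t=1$ of the numerator of the reduced form $h(t)/(1-t)^{\dim(P/I)}$ of the Hilbert series of $P/I$. *)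

(* Defs.v *)
From Stdlib Require Import ClassicalEpsilon.
From HB Require Import structures.
From mathcomp Require Import all_boot all_order all_algebra.
From mathcomp.multinomials Require Import mpoly.

Set Implicit Arguments.
Unset Strict Implicit.
Unset Printing Implicit Defensive.

Import GRing.Theory.

Local Open Scope ring_scope.

Definition ideal_gen (R : comNzRingType) (S : R -> Prop) (f : R) : Prop :=
  exists2 s : seq (R * R),
    (forall x, x \in s -> S x.2) & f = \sum_(x <- s) x.1 * x.2.

(* In the presence of excluded middle in informative form (ClassicalEpsilon),
   boolean predicates are arbitrary subsets, so [prime_idealr R] is the type of
   all prime ideals of [R]. *)
Definition prime_chain (R : comNzRingType) (d : nat)
    (c : 'I_d.+1 -> prime_idealr R) : Prop :=
  forall i j : 'I_d.+1, (i < j)%N ->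
    {subset c i <= c j} /\ ~ {subset c j <= c i}.

Definition has_krull_dim (R : comNzRingType) (d : nat) : Prop :=
  (exists c : 'I_d.+1 -> prime_idealr R, prime_chain c) /\
  (forall (e : nat) (c : 'I_e.+1 -> prime_idealr R), prime_chain c -> (e <= d)%N).

(* The classes of [b 0, ..., b (m - 1)] form a basis of [V / W]. *)
Definition quotient_basis (K : fieldType) (V : lmodType K) (W : V -> Prop)
    (m : nat) (b : 'I_m -> V) : Prop :=
  forall v : V, exists! c : 'rV[K]_m, W (v - \sum_(j < m) c 0 j *: b j).

Definition quotient_dim (K : fieldType) (V : lmodType K) (W : V -> Prop) : nat :=
  epsilon (inhabits 0%N)
    (fun m => exists b : 'I_m -> V, quotient_basis W b).

Section Graded.

Variables (K : fieldType) (n : nat).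
Local Notation P := {mpoly K[n]}.

Definition graded_quotient_dim (J : P -> Prop) (d : nat) : nat :=
  quotient_dim (fun f : dhomog n K d => J (val f)).

Definition homogeneous_ideal (I : idealr P) : Prop :=
  forall (f : P) (d : nat), f \in I -> pihomog mdeg d f \in I.

Definition generated_in_degree_le (I : idealr P) (e : nat) : Prop :=
  exists2 S : P -> Prop,
    (forall f, S f -> exists2 d, (d <= e)%N & f \is d.-homog) &
    (forall f, f \in I <-> ideal_gen S f).

Definition linear_form (k : nat) (A : 'M[K]_(k, n)) (r : 'I_k) : P :=
  \sum_(j < n) A r j *: 'X_j.

Definition section_ideal (I : idealr P) (k : nat) (A : 'M[K]_(k, n)) (f : P) :
    Prop :=
  exists g h : P,
    [/\ g \in I, ideal_gen (fun l => exists r, l = linear_form A r) h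
      & f = g + h].

(* Matrices of size k x n are identified with points of the affine space
   K^(k * n) through [mxvec]. *)
Definition zariski_open (k : nat) (U : 'M[K]_(k, n) -> Prop) : Prop :=
  exists S : {mpoly K[k * n]} -> Prop,
    forall A, U A <-> exists2 F, S F & F.@[fun t => mxvec A 0 t] != 0.

Definition generic_section_dim (I : idealr P) (k d m : nat) : Prop :=
  exists U : 'M[K]_(k, n) -> Prop,
    [/\ zariski_open U, exists A, U A &
        forall A, U A -> graded_quotient_dim (section_ideal I A) d = m].

(* Meaningful for 1 <= i <= n. *)
Definition sectional_matrix (I : idealr P) (i d : nat) : nat :=
  epsilon (inhabits 0%N) (generic_section_dim I (n - i) d).

Definition hilbert_function (I : idealr P) (d : nat) : nat :=
  graded_quotient_dim (fun f => f \in I) d.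

(* The Hilbert series of P/I equals h(t) / (1 - t)^D: coefficientwise,
   (1 - t)^D * \sum_d (hilbert_function I d) t^d = h(t). *)
Definition hilbert_series_eq (I : idealr P) (h : {poly int}) (D : nat) : Prop :=
  forall d : nat,
    \sum_(j < d.+1)
      ((1 - 'X : {poly int}) ^+ D)`_j * (hilbert_function I (d - j))%:Z = h`_d.

Definition has_multiplicity (I : idealr P) (e : nat) : Prop :=
  exists (D : nat) (h : {poly int}),
    [/\ has_krull_dim {ideal_quot I} D, hilbert_series_eq I h D,
        h.[1] != 0 & h.[1] = e%:Z].

End Graded.

(* Main.v *)
Require Import Defs.
From Stdlib Require Import ClassicalEpsilon.
From HB Require Import structures.
From mathcomp Require Import all_boot all_order all_algebra.
From mathcomp.multinomials Require Import mpoly.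
From mathcomp Require Import zify ring.

Set Implicit Arguments.
Unset Strict Implicit.
Unset Printing Implicit Defensive.

Import GRing.Theory Order.TTheory VectorInternalTheory.
Local Open Scope ring_scope.

(** Why the theorem holds.  Write D = n - i + 1 and cut P/I by generic linear
    forms L_1, ..., L_D.  By the choice of i, the quotient by all of them vanishes
    in degree delta (if i > 1) or in all positive degrees (if i = 1), so on the
    quotient A by the first D - 1 of them, multiplication by L = L_D is surjective
    from degree delta on.  The equality of the two values of the sectional matrix
    says that A has the same dimension m in degrees delta and delta + 1, so there
    it is also injective.

    The main step (injective_step, persistence) propagates this injectivity to all
    higher degrees.  It uses that the ideal of A has no generators in degrees above
    delta + 1: division by L is defined on monomials one degree up by
    (X_k mu) / L = X_k (mu / L); this does not depend on the variable X_k split off,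
    hence it is compatible with the relations of A, and so L stays injective.
    Consequently A has Hilbert function m in every degree >= delta.

    It remains to climb back from A to P/I.  The forms can be chosen such that each
    is filter-regular on the preceding quotient (multiplication by it is injective
    in large degrees) and such that a homogeneous prime, other than the irrelevant
    ideal, that contains it is never minimal over the preceding ideal.  Both
    properties hold for a linear form outside finitely many primes, those of a
    filtration of P/J with quotients P/p (devissage, generic_linear_form); such a
    filtration exists because P is Noetherian.  Filter-regularity shows that
    undoing one cut divides the Hilbert series by 1 - t up to a polynomial, which
    does not change the value of the numerator at 1 (series_of_sections).  The
    statement on primes produces a chain of D + 1 primes above I by going down from
    a prime of A (chain_from_sections).  Longer chains do not exist: a chain of
    length e gives about N^e monomials of degree O(N) that are independent modulo I
    (chain_independent), whereas the dimension of P/I in degrees up to N is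
    O(N^D), because the quotient by D linear forms is finite (hf_growth).

    Genericity enters through line_open sets, the sets that contain all but
    finitely many points of every line through one of their points.  They include
    the Zariski open sets, and two nonempty ones meet since K is infinite. *)

(** * Dimensions of quotients *)

Lemma max_nat (Q : nat -> Prop) (b : nat) :
  (exists k, Q k) -> (forall k, Q k -> (k <= b)%N) ->
  exists k, Q k /\ forall l, Q l -> (l <= k)%N.
Proof.
elim: b => [|b IH] [k Qk] Qb; first by exists k; split=> // l /Qb; have := Qb _ Qk; lia.
have [Qb1|nQ] := classic (Q b.+1); first by exists b.+1.
apply: IH; first by exists k.
move=> l Ql; have := Qb _ Ql; rewrite leq_eqVlt => /predU1P[e|]; last by lia.
by case: nQ; rewrite -e.
Qed.

Section QuotientDim.
Variables (K : fieldType) (V : vectType K) (W : V -> Prop).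

(** A space of maximal dimension among those inside W exhausts W. *)
Lemma subspace_vspace :
  W 0 -> (forall a u v, W u -> W v -> W (a *: u + v)) ->
  exists U : {vspace V}, forall v, v \in U <-> W v.
Proof.
move=> W0 Wlin.
pose Q k := exists2 U : {vspace V}, \dim U = k & forall v, v \in U -> W v.
have [||k [[U dU sU] kmax]] := @max_nat Q (\dim (fullv : {vspace V})).
- by exists 0%N; exists 0%VS; rewrite ?dimv0 // => v; rewrite memv0 => /eqP->.
- by move=> k [U <- _]; exact: dimvS (subvf U).
exists U => v; split; first exact: sU.
move=> Wv; have sub : (U <= U + <[v]>)%VS by exact: addvSl.
suff e : U == (U + <[v]>)%VS by rewrite (eqP e) (subvP (addvSr _ _)) ?memv_line.
rewrite eqEdim sub dU; apply: kmax; exists (U + <[v]>)%VS => // w.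
by case/memv_addP=> u uU [_ /vlineP[c ->] ->]; rewrite addrC; apply/Wlin/sU.
Qed.

(** Representatives of a basis of V / W span a complement of U.  So the number
    chosen in the definition of quotient_dim is unique, and bases of complements
    show that it exists. *)
Lemma quotient_dimE (U : {vspace V}) : (forall v, v \in U <-> W v) ->
  (quotient_dim W + \dim U = \dim {:V})%N.
Proof.
move=> UW.
have uniqm : forall m, (exists b : 'I_m -> V, quotient_basis W b) ->
    (m + \dim U = \dim {:V})%N.
  move=> m [b bP]; pose X := [tuple b j | j < m].
  have XE (c : 'I_m -> K) : \sum_j c j *: X`_j = \sum_j c j *: b j.
    by apply: eq_bigr => j _; rewrite -tnth_nth tnth_mktuple.
  have rowE (c : 'I_m -> K) : \sum_j (\row_j c j) 0 j *: b j = \sum_j c j *: b j.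
    by apply: eq_bigr => j _; rewrite mxE.
  have uni (c : 'I_m -> K) : \sum_j c j *: b j \in U -> forall j, c j = 0.
    move=> Wc j; have [c0 [_ cu]] := bP (\sum_j c j *: b j).
    have e1 : c0 = \row_j c j by apply: cu; rewrite rowE subrr; apply/UW; exact: mem0v.
    have e2 : c0 = 0.
      apply: cu; rewrite [X in _ - X]big1 ?subr0; first exact/UW.
      by move=> k _; rewrite mxE scale0r.
    by move: e1; rewrite e2 => /rowP/(_ j); rewrite !mxE.
  have frX : free X.
    apply/freeP => k; rewrite XE => k0; apply: uni; rewrite k0; exact: mem0v.
  have <- : \dim <<X>>%VS = m by rewrite (eqnP frX) size_tuple.
  rewrite -dimv_sum_cap.
  have -> : (<<X>> :&: U = 0)%VS.
    apply/eqP; rewrite -subv0; apply/subvP => v; rewrite memv_cap => /andP[vX vU].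
    have := coord_span vX; rewrite XE => vE; rewrite memv0 vE big1 // => j _.
    by rewrite (uni (fun j => coord X j v)) ?scale0r // -vE.
  rewrite dimv0 addn0; congr (\dim _); apply/vspaceP => v; rewrite memvf.
  have [c [Wc _]] := bP v; rewrite -(subrK (\sum_(j < m) c 0 j *: b j) v) addrC.
  apply: memv_add; last by apply/UW.
  by apply: memv_suml => j _; rewrite memvZ // memv_span //; apply/mapP; exists j;
    rewrite ?mem_enum.
apply: uniqm.
apply: (epsilon_spec _ (fun m => exists b : 'I_m -> V, quotient_basis W b)).
pose Y := vbasis U^C%VS; exists (\dim U^C), (fun j => Y`_j) => v.
have YP : basis_of U^C%VS Y by exact: vbasisP.
have cap (c : 'I_(\dim U^C) -> K) : \sum_j c j *: Y`_j \in U -> forall j, c j = 0.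
  move=> cU; have /freeP := basis_free YP; apply.
  apply/eqP; rewrite -memv0 -(capv_compl U) memv_cap cU /=.
  by apply: memv_suml => j _; rewrite memvZ // vbasis_mem // mem_nth // size_tuple.
have : v \in (U + U^C)%VS by rewrite addv_complf memvf.
case/memv_addP => u uU [w wC ->].
have wE := coord_basis YP wC.
exists (\row_j coord Y j w); split.
  apply/UW; rewrite {1}wE -addrA -sumrB big1 ?addr0 // => j _.
  by rewrite mxE subrr.
move=> c /UW cU; apply/rowP => j; rewrite mxE; apply/eqP; rewrite -subr_eq0; apply/eqP.
apply: (cap (fun j => coord Y j w - c 0 j)).
have -> : \sum_j (coord Y j w - c 0 j) *: Y`_j = (u + w - \sum_j c 0 j *: Y`_j) - u.
  rewrite [in RHS]addrAC [u + w]addrC addrK {2}wE -sumrB.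
  by apply: eq_bigr => i _; rewrite scalerBl.
by rewrite rpredB.
Qed.
End QuotientDim.

(** * Ideals and Hilbert functions *)

Section Ideals.
Variable R : comNzRingType.
Implicit Types J p : R -> Prop.

Record is_ideal J : Prop := IsIdeal {
  ideal0 : J 0;
  idealD : forall a b, J a -> J b -> J (a + b);
  idealM : forall r a, J a -> J (r * a) }.

Record is_prime p : Prop := IsPrime {
  prime_is_ideal : is_ideal p;
  prime1 : ~ p 1;
  primeM : forall a b, p (a * b) -> p a \/ p b }.

Definition add_gen J (f : R) : R -> Prop := fun x => exists g, J (x - g * f).

Definition colon J (f : R) : R -> Prop := fun x => J (x * f).

Section Basics.
Variable J : R -> Prop.
Hypothesis idJ : is_ideal J.

Lemma ideal_mulr r a : J a -> J (a * r).
Proof. by rewrite mulrC; exact: idealM. Qed.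

Lemma idealN a : J a -> J (- a).
Proof. by move=> Ja; rewrite -mulN1r; exact: idealM. Qed.

Lemma idealB a b : J a -> J b -> J (a - b).
Proof. by move=> Ja Jb; apply: idealD => //; exact: idealN. Qed.

Lemma ideal_sum (T : Type) (r : seq T) (Q : pred T) (F : T -> R) :
  (forall t, Q t -> J (F t)) -> J (\sum_(t <- r | Q t) F t).
Proof. by move=> JF; apply: big_ind => //; [exact: ideal0 | exact: idealD]. Qed.

Lemma ideal_subl a b : J (a - b) -> J b -> J a.
Proof. by move=> Jab Jb; rewrite -(subrK b a); exact: idealD. Qed.

Lemma ideal_subr a b : J (a - b) -> J a -> J b.
Proof. by move=> Jab Ja; rewrite -[b](subKr a); exact: idealB. Qed.

Lemma colon_ideal f : is_ideal (colon J f).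
Proof.
split; rewrite /colon ?mul0r; first exact: ideal0.
  by move=> a b Ja Jb; rewrite mulrDl; exact: idealD.
by move=> r a Ja; rewrite -mulrA; exact: idealM.
Qed.

Lemma sub_colon f x : J x -> colon J f x.
Proof. exact: ideal_mulr. Qed.

Lemma add_gen_ideal f : is_ideal (add_gen J f).
Proof.
split; first by exists 0; rewrite mul0r subr0; exact: ideal0.
  move=> a b [g Ja] [h Jb]; exists (g + h).
  by rewrite mulrDl opprD addrACA; exact: idealD.
by move=> r a [g Ja]; exists (r * g); rewrite -mulrA -mulrBr; exact: idealM.
Qed.

Lemma sub_add_gen f x : J x -> add_gen J f x.
Proof. by move=> Jx; exists 0; rewrite mul0r subr0. Qed.

Lemma mem_add_gen f : add_gen J f f.
Proof. by exists 1; rewrite mul1r subrr; exact: ideal0. Qed.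

Lemma add_gen_sub f L : is_ideal L -> (forall x, J x -> L x) -> L f ->
  forall x, add_gen J f x -> L x.
Proof.
move=> idL JL Lf x [g /JL Lx]; rewrite -(subrK (g * f) x).
by apply: idealD => //; exact: idealM.
Qed.

End Basics.

End Ideals.

Section Graded.
Variables (K : fieldType) (n : nat).
Local Notation P := {mpoly K[n.+1]}.
Local Notation V := (dhomog n.+1 K).
Local Notation pi := (pihomog mdeg).
Implicit Types J : P -> Prop.

Definition is_homog J : Prop := forall f d, J f -> J (pi d f).

Lemma pihomog_homog d e (f : P) : f \is e.-homog ->
  pi d f = if d == e then f else 0 :> P.
Proof.
move=> hf; case: eqP => [->|/eqP ne]; first by rewrite pihomog_dE.
by rewrite (pihomog_ne0 _ hf) // eq_sym.
Qed.

Lemma pihomogM e k (f g : P) : f \is k.-homog ->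
  pi e (g * f) = if (k <= e)%N then pi (e - k) g * f else 0.
Proof.
move=> hf; pose N := maxn (msize g) (e - k).+1.
have le_N : (msize g <= N)%N by exact: leq_maxl.
rewrite {1}(pihomog_partitionE le_N) mulr_suml raddf_sum /=.
have pE (j : 'I_N) : pi e (pi j g * f) = if e == (j + k)%N then pi j g * f else 0.
  by rewrite (@pihomog_homog _ (j + k)) //; exact/dhomogM/hf/pihomogP.
have ltN : (e - k < N)%N by rewrite leq_maxr.
case: leqP => ke; last by rewrite big1 // => j _; rewrite pE; case: eqP => //; lia.
rewrite (bigD1 (Ordinal ltN)) // pE /= subnK // eqxx big1 ?addr0 // => j jN.
rewrite pE; case: eqP => // ej; case/eqP: jN; apply: val_inj => /=; lia.
Qed.

Lemma add_gen_homog J f k : is_homog J -> is_ideal J -> f \is k.-homog ->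
  is_homog (add_gen J f).
Proof.
move=> hJ idJ fk x d [g Jx]; have := hJ _ d Jx.
rewrite raddfB /= (pihomogM _ _ fk); case: leqP => _; first by exists (pi (d - k) g).
by rewrite subr0; exact: sub_add_gen.
Qed.

Lemma colon_homog J f k : is_homog J -> f \is k.-homog -> is_homog (colon J f).
Proof.
move=> hJ fk x d Jx; rewrite /colon; have := hJ _ (d + k)%N Jx.
by rewrite (pihomogM _ _ fk) leq_addl addnK.
Qed.

(** Ideals are membership predicates, so this is how homogeneity gets used:
    membership can be tested one degree at a time. *)
Lemma homog_parts J f : is_ideal J -> (forall d, J (pi d f)) -> J f.
Proof.
by move=> idJ Jf; rewrite (pihomog_partitionE (leqnn (msize f))); exact: ideal_sum.
Qed.

Definition degree_part J d : {vspace V d} :=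
  epsilon (inhabits 0%VS) (fun U => forall v : V d, v \in U <-> J (val v)).

Lemma mem_degree_part J d : is_ideal J -> forall v : V d, v \in degree_part J d <-> J (val v).
Proof.
move=> idJ.
apply: (epsilon_spec _ (fun U : {vspace V d} => forall v : V d, v \in U <-> J (val v))).
apply: subspace_vspace; first exact: ideal0.
move=> a u v Ju Jv /=; rewrite -mul_mpolyC.
by apply: idealD => //; exact: idealM.
Qed.

Definition hf J d : nat := graded_quotient_dim J d.

Lemma hfE J d : is_ideal J -> (hf J d + \dim (degree_part J d) = \dim {:V d})%N.
Proof. by move=> idJ; apply: quotient_dimE => v; exact: mem_degree_part. Qed.

Lemma hf_le J L d : is_ideal J -> is_ideal L ->
  (forall f, f \is d.-homog -> J f -> L f) -> (hf L d <= hf J d)%N.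
Proof.
move=> idJ idL sub; have : (\dim (degree_part J d) <= \dim (degree_part L d))%N.
  apply/dimvS/subvP => v /(mem_degree_part idJ) Jv; apply/(mem_degree_part idL)/sub => //.
  exact: valP.
by have := hfE d idJ; have := hfE d idL; lia.
Qed.

Lemma hf_eq J L d : is_ideal J -> is_ideal L ->
  (forall f, f \is d.-homog -> J f <-> L f) -> hf J d = hf L d.
Proof. by move=> idJ idL JL; apply/eqP; rewrite eqn_leq !hf_le // => f /JL[]. Qed.

Lemma hf_le_eq J L d : is_ideal J -> is_ideal L ->
  (forall f, f \is d.-homog -> J f -> L f) -> (hf J d <= hf L d)%N ->
  forall f, f \is d.-homog -> L f -> J f.
Proof.
move=> idJ idL sub le f fd Lf; suff e : degree_part J d == degree_part L d.
  by apply/(mem_degree_part idJ (DHomog fd)); rewrite (eqP e); apply/(mem_degree_part idL).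
rewrite eqEdim; apply/andP; split.
  apply/subvP => v /(mem_degree_part idJ) Jv.
  by apply/(mem_degree_part idL)/sub => //; exact: valP.
by have := hfE d idJ; have := hfE d idL; lia.
Qed.

Lemma hf_eq0 J d : is_ideal J -> hf J d = 0%N <-> forall f, f \is d.-homog -> J f.
Proof.
move=> idJ; have dE := hfE d idJ; split=> [h0 f fd|Jd].
  apply/(mem_degree_part idJ (DHomog fd)); suff -> : degree_part J d = fullv by rewrite memvf.
  by apply/eqP; rewrite eqEdim subvf /=; lia.
suff e : degree_part J d = fullv by move: dE; rewrite e; lia.
by apply/vspaceP => v; rewrite memvf; apply/(mem_degree_part idJ)/Jd/valP.
Qed.

(** Exactness of 0 -> P/(J : f)(-k) -> P/J -> P/(J + (f)) -> 0 in degree d + k: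
    multiplication by f maps the forms of degree d to those of degree d + k, the
    preimage of J is J : f, and it contains the kernel. *)
Lemma hf_exact J f k d : is_ideal J -> is_homog J -> f \is k.-homog ->
  hf J (d + k) = (hf (add_gen J f) (d + k) + hf (colon J f) d)%N.
Proof.
move=> idJ hJ fk.
pose mulf (v : V d) : V (d + k) := DHomog (dhomogM (valP v) fk).
have mulf_lin : linear mulf.
  by move=> c u v; apply: val_inj => /=; rewrite mulrDl scalerAl.
pose mulfL := GRing.isLinear.Build _ _ _ _ mulf mulf_lin.
pose mulf' : {linear V d -> V (d + k)} := HB.pack mulf mulfL.
pose phi := linfun mulf'.
have phiE v : val (phi v) = val v * f by rewrite lfunE.
have idA := add_gen_ideal idJ f; have idC := colon_ideal idJ f.
have kerC : (lker phi <= degree_part (colon J f) d)%VS.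
  apply/subvP => v; rewrite memv_ker => /eqP v0; apply/(mem_degree_part idC).
  by rewrite /colon -phiE v0; exact: ideal0.
have segA : degree_part (add_gen J f) (d + k) = (degree_part J (d + k) + phi @: fullv)%VS.
  apply/vspaceP => v; apply/idP/idP => [/(mem_degree_part idA)[g Jg]|].
    have Jd := hJ _ (d + k)%N Jg; move: Jd.
    rewrite raddfB /= (pihomogM _ _ fk) leq_addl addnK pihomog_dE; last exact: valP.
    move=> Jv; pose w : V d := DHomog (pihomogP mdeg d g).
    rewrite -(subrK (phi w) v); apply: memv_add; last exact/memv_img/memvf.
    by apply/(mem_degree_part idJ); rewrite raddfB /= phiE.
  case/memv_addP => u /(mem_degree_part idJ) Ju [_ /memv_imgP[w _ ->] ->].
  by apply/(mem_degree_part idA); exists (val w); rewrite raddfD /= phiE addrK.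
have segC : (degree_part J (d + k) :&: phi @: fullv)%VS =
    (phi @: degree_part (colon J f) d)%VS.
  apply/vspaceP => v; rewrite memv_cap; apply/andP/memv_imgP.
    case=> /(mem_degree_part idJ) Jv /memv_imgP[w _ vE]; exists w => //.
    by apply/(mem_degree_part idC); rewrite /colon -phiE -vE.
  case=> w /(mem_degree_part idC) Jw ->; split; last exact/memv_img/memvf.
  by apply/(mem_degree_part idJ); rewrite phiE.
have e1 := limg_ker_dim phi fullv; have e2 := limg_ker_dim phi (degree_part (colon J f) d).
rewrite (capv_idPr kerC) in e2; rewrite (capv_idPr (subvf _)) in e1.
have e3 := dimv_sum_cap (degree_part J (d + k)) (phi @: fullv); rewrite segC -segA in e3.
have count (x y z u1 u2 u3 a b c e g : nat) : (x + u1 = a)%N -> (y + u2 = a)%N ->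
    (z + u3 = b)%N -> (c + e = b)%N -> (c + g = u3)%N -> (u2 + g = u1 + e)%N ->
    x = (y + z)%N by lia.
exact: count (hfE _ idJ) (hfE _ idA) (hfE _ idC) e1 e2 e3.
Qed.

End Graded.

(** * The basis theorem *)

Lemma min_nat (Q : nat -> Prop) :
  (exists k, Q k) -> exists k, Q k /\ forall l, (l < k)%N -> ~ Q l.
Proof.
case=> k; elim/ltn_ind: k => k IH Qk.
have [[l [lk Ql]]|nl] := classic (exists l, (l < k)%N /\ Q l); first exact: IH Ql.
by exists k; split=> // l lk Ql; apply: nl; exists l.
Qed.

(** Each chosen index carries the least of all later values. *)
Lemma nondecreasing_subseq (f : nat -> nat) : exists phi : nat -> nat,
  {homo phi : a b / (a < b)%N} /\ {homo f \o phi : a b / (a <= b)%N}.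
Proof.
have minf m : exists j, (m <= j)%N /\ forall l, (m <= l)%N -> (f j <= f l)%N.
  have [|v [[j mj vE] vmin]] := @min_nat (fun v => exists2 j, (m <= j)%N & v = f j).
    by exists (f m); exists m.
  exists j; split=> // l ml; rewrite leqNgt; apply/negP => lt.
  by apply: (vmin (f l)); [rewrite vE | exists l].
pose g m := sval (constructive_indefinite_description _ (minf m)).
have gP m : (m <= g m)%N /\ forall l, (m <= l)%N -> (f (g m) <= f l)%N.
  by rewrite /g; case: constructive_indefinite_description.
pose phi := fix phi k := if k is k'.+1 then g (phi k').+1 else g 0%N.
have phiS k : (phi k < phi k.+1)%N by exact: (gP _).1.
exists phi; split; first exact: homo_ltn ltn_trans phiS.
apply: (homo_leq leqnn leq_trans) => k /=.
case: k => [|k]; apply: (gP _).2; last exact: leq_trans (phiS k) (ltnW (phiS k.+1)).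
exact: leq0n.
Qed.

(** Dickson's lemma: pass to subsequences that are nondecreasing in one more
    variable at a time. *)
Lemma dickson n (s : nat -> 'X_{1..n}) :
  exists i j, (i < j)%N /\ (s i <= s j)%MM.
Proof.
have sub k : exists phi : nat -> nat, {homo phi : a b / (a < b)%N} /\
    forall i : 'I_n, (i < k)%N -> {homo (fun a => s (phi a) i) : a b / (a <= b)%N}.
  elim: k => [|k [phi [phi_lt phi_le]]]; first by exists id; split=> [a b|i]; rewrite ?ltn0.
  have [kn|nk] := ltnP k n; last first.
    by exists phi; split=> // i ik; apply: phi_le; apply: leq_trans nk.
  have [psi [psi_lt psi_le]] := nondecreasing_subseq (fun a => s (phi a) (Ordinal kn)).
  exists (phi \o psi); split; first by move=> a b /psi_lt /phi_lt.
  move=> i; rewrite ltnS leq_eqVlt => /predU1P[ik|ik] a b ab.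
    by have -> : i = Ordinal kn by [exact: val_inj]; apply: psi_le.
  by apply: phi_le => //; move: ab; rewrite leq_eqVlt => /predU1P[->//|/psi_lt/ltnW].
have [phi [phi_lt phi_le]] := sub n.
exists (phi 0%N), (phi 1%N); split; first exact: phi_lt.
by apply/mnm_lepP => i; apply: phi_le.
Qed.

Section Noetherian.
Variables (K : fieldType) (n : nat).
Local Notation P := {mpoly K[n]}.

(** Hilbert's basis theorem as an induction principle: an infinite strictly
    increasing chain of ideals would have elements f_k in J_(k+1) \ J_k with
    minimal leading monomials; by Dickson's lemma one of these divides a later
    one, and reducing the later element contradicts its minimality. *)
Lemma noetherian_ind (Q : (P -> Prop) -> Prop) :
  (forall J, is_ideal J ->
     (forall L, is_ideal L -> (forall x, J x -> L x) ->
        (exists x, L x /\ ~ J x) -> Q L) -> Q J) ->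
  forall J, is_ideal J -> Q J.
Proof.
move=> step J0 idJ0; apply: NNPP => nQ0.
pose bad J := is_ideal J /\ ~ Q J.
have next (J : {J | bad J}) : exists L : {J | bad J},
    (forall x, sval J x -> sval L x) /\ exists x, sval L x /\ ~ sval J x.
  case: J => J [idJ nQ] /=; apply: NNPP => nL; apply: nQ; apply: step => // L idL JL xL.
  by apply: NNPP => nQL; apply: nL; exists (exist _ L (conj idL nQL)).
pose nx J := sval (constructive_indefinite_description _ (next J)).
have nxP J : (forall x, sval J x -> sval (nx J) x) /\
    exists x, sval (nx J) x /\ ~ sval J x.
  by rewrite /nx; case: constructive_indefinite_description.
pose c k := iter k nx (exist _ J0 (conj idJ0 nQ0) : {J | bad J}).
have idc k : is_ideal (sval (c k)) by case: (c k) => J [].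
have c_sub : forall i j x, (i <= j)%N -> sval (c i) x -> sval (c j) x.
  move=> i j x /subnK <-; elim: (j - i)%N => // m IH /IH.
  by rewrite addSn; exact: (nxP _).1.
pose D k f := sval (c k.+1) f /\ ~ sval (c k) f.
have minD k : exists f, D k f /\ forall g, D k g -> ~~ (mlead g < mlead f)%O.
  have [f Df] : exists f, D k f by exact: (nxP _).2.
  have [m mE] : exists m, m = mlead f by exists (mlead f).
  elim/(well_founded_ind (@ltom_wf n)): m f Df mE => m IH f Df mE.
  have [[g [Dg lt]]|ng] := classic (exists g, D k g /\ (mlead g < mlead f)%O).
    by apply: (IH _ _ g Dg erefl); rewrite mE.
  by exists f; split=> // g Dg; apply/negP => lt; apply: ng; exists g.
pose f k := sval (constructive_indefinite_description _ (minD k)).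
have fP k : D k (f k) /\ forall g, D k g -> ~~ (mlead g < mlead (f k))%O.
  by rewrite /f; case: constructive_indefinite_description.
have f0 k : f k != 0.
  by apply/eqP => e; case: (fP k) => [[_ []]]; rewrite e; exact: ideal0.
have [i [j [ij le]]] := dickson (fun k => mlead (f k)).
pose t := (mleadc (f j) / mleadc (f i)) *: 'X_[mlead (f j) - mlead (f i)] : P.
have lci : mleadc (f i) != 0 by rewrite mleadc_eq0.
have lcj : mleadc (f j) != 0 by rewrite mleadc_eq0.
have q0 : mleadc (f j) / mleadc (f i) != 0 by rewrite mulf_neq0 ?invr_eq0.
have t0 : t != 0 by rewrite -mleadc_eq0 mleadcZE mleadXm mcoeffX eqxx mulr1.
have leadt : mlead (t * f i) = mlead (f j).
  by rewrite mleadM // /t mleadZ // mleadXm submK.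
have lcE : (t * f i)@_(mlead (f j)) = mleadc (f j).
  rewrite -{1}leadt mleadM // mleadcM /t mleadcZE mleadXm mcoeffX eqxx mulr1.
  by rewrite divfK.
have Dg : D j (f j - t * f i).
  have fi : sval (c j) (t * f i).
    by apply: idealM => //; apply: c_sub ij _; case: (fP i) => [[]].
  case: (fP j) => [[fj nfj] _]; split.
    by apply: idealB => //; apply: c_sub (leqnSn j) _.
  by move=> Jg; apply: nfj; apply: (ideal_subl _ Jg).
have g0 : f j - t * f i != 0.
  by apply/eqP => e; case: Dg => _; rewrite e; case; exact: ideal0.
have := (fP j).2 _ Dg; rewrite lt_neqAle negb_and negbK.
have le_lead : (mlead (f j - t * f i) <= mlead (f j))%O.
  by have := mleadB_le (f j) (t * f i); rewrite leadt joinxx.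
rewrite le_lead orbF => /eqP e; move: g0; rewrite -mleadc_eq0 e mcoeffB lcE.
by rewrite subrr eqxx.
Qed.
End Noetherian.

(** * Generic linear forms and prime filtrations *)

Section LineOpen.
Variables (K : fieldType) (charK : [pchar K] =i pred0).

Lemma fresh_scalar (s : seq K) : exists t, t \notin s.
Proof.
apply: NNPP => nt; pose r := mkseq (fun k => k%:R : K) (size s).+1.
suff : (size r <= size s)%N by rewrite size_mkseq ltnn.
apply: uniq_leq_size => [|t _]; last by apply: contraT => ts; case: nt; exists t.
apply/(uniqP 0) => i j; rewrite !inE size_mkseq => lti ltj; rewrite !nth_mkseq //.
move/pcharf0P: charK => ch; wlog ij : i j lti ltj / (i <= j)%N.
  by move=> W e; case/orP: (leq_total i j) => l; [|symmetry]; apply: W.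
move=> e; have /eqP : (j - i)%:R = 0 :> K by rewrite natrB // e subrr.
by rewrite ch; lia.
Qed.

Lemma root_list (q : {poly K}) : q != 0 -> exists s : seq K, forall t, root q t -> t \in s.
Proof.
elim: {q}(size q) {-2}q (erefl (size q)) => [|k IH] q.
  by move/eqP; rewrite size_poly_eq0 => ->.
move=> sq q0; have [[t rt]|nr] := classic (exists t, root q t); last first.
  by exists [::] => t rt; case: nr; exists t.
case/factor_theorem: (rt) => q' qE; have q'0 : q' != 0.
  by apply: contraNneq q0 => e; rewrite qE e mul0r.
case: (IH q' _ q'0) => [|s sP].
  by move: sq; rewrite qE size_Mmonic ?monicXsubC // size_XsubC addn2 => -[].
exists (t :: s) => u; rewrite qE rootM root_XsubC inE => /orP[/sP ->|->//].
by rewrite orbT.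
Qed.

Section Defs.
Variable V : lmodType K.
Implicit Types U : V -> Prop.

(** A weakening of Zariski openness that is stable under finite intersections
    and under restriction to affine subspaces, and for which two nonempty sets
    still meet because the field is infinite. *)
Definition line_open U := forall u w, U u ->
  exists s : seq K, forall t, t \notin s -> U (u + t *: (w - u)).

Lemma line_openI U U' : line_open U -> line_open U' ->
  line_open (fun v => U v /\ U' v).
Proof.
move=> oU oU' u w [Uu Uu']; have [s sP] := oU u w Uu; have [s' sP'] := oU' u w Uu'.
exists (s ++ s') => t; rewrite mem_cat negb_or => /andP[ts ts'].
by split; [exact: sP | exact: sP'].
Qed.

(** On the line from a point of U to a point of U', all but finitely many points
    lie in both sets. *)
Lemma line_open_meet U U' : line_open U -> line_open U' ->
  (exists u, U u) -> (exists u, U' u) -> exists v, U v /\ U' v.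
Proof.
move=> oU oU' [u Uu] [w Uw]; have [s sP] := oU u w Uu; have [s' sP'] := oU' w u Uw.
have [t] := fresh_scalar (s ++ [seq 1 - x | x <- s']).
rewrite mem_cat negb_or => /andP[ts ts'].
exists (u + t *: (w - u)); split; first exact: sP.
have -> : u + t *: (w - u) = w + (1 - t) *: (u - w).
  rewrite scalerBl scale1r addrA [w + (u - w)]addrC subrK.
  by rewrite -[in RHS](opprB w u) scalerN opprK.
apply: sP'; apply: contra ts' => t's; apply/mapP; exists (1 - t) => //.
by rewrite opprB addrC subrK.
Qed.

(** A line that is not contained in W meets it in at most one point. *)
Lemma line_open_subspace (W : V -> Prop) :
  (forall a u v, W u -> W v -> W (a *: u + v)) -> line_open (fun v => ~ W v).
Proof.
move=> Wlin u w nu.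
have [[t0 W0]|nt] := classic (exists t, W (u + t *: (w - u))); last first.
  by exists [::] => t _ Wt; apply: nt; exists t.
exists [:: t0] => t; rewrite inE -subr_eq0 => tt0 Wt; apply: nu.
have Wd : W ((t - t0) *: (w - u)).
  have -> : (t - t0) *: (w - u) = -1 *: (u + t0 *: (w - u)) + (u + t *: (w - u)).
    by rewrite scaleN1r opprD addrACA addNr add0r scalerBl addrC.
  exact: Wlin.
have -> : u = (- t0 / (t - t0)) *: ((t - t0) *: (w - u)) + (u + t0 *: (w - u)).
  by rewrite scalerA divfK // scaleNr addrC addrK.
exact: Wlin.
Qed.

Lemma line_open_poly (f : V -> K) :
  (forall u w, exists q : {poly K}, forall t, f (u + t *: (w - u)) = q.[t]) ->
  line_open (fun v => f v != 0).
Proof.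
move=> fpoly u w fu; have [q qE] := fpoly u w.
have q0 : q != 0.
  by apply: contraNneq fu => q0; rewrite -[u](addr0 u) -(scale0r (w - u)) qE q0 horner0.
by have [s sP] := root_list q0; exists s => t; rewrite qE; exact/contra/sP.
Qed.
End Defs.

Lemma line_open_affine (V W : lmodType K) (U : V -> Prop) (phi : W -> V) :
  (forall u w t, phi (u + t *: (w - u)) = phi u + t *: (phi w - phi u)) ->
  line_open U -> line_open (fun v => U (phi v)).
Proof.
by move=> aff oU u w Uu; have [s sP] := oU _ (phi w) Uu; exists s => t /sP; rewrite aff.
Qed.
End LineOpen.

Section Devissage.
Variables (K : fieldType) (n : nat).
Local Notation P := {mpoly K[n.+1]}.
Local Notation pi := (pihomog mdeg).
Implicit Types J p q : P -> Prop.

Record hideal J : Prop := HIdeal { hideal_ideal : is_ideal J; hideal_homog : is_homog J }.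

Definition hprime p : Prop := is_prime p /\ is_homog p.

Lemma add_gen_hideal J f k : hideal J -> f \is k.-homog -> hideal (add_gen J f).
Proof. by case=> idJ hJ fk; split; [exact: add_gen_ideal | exact: add_gen_homog fk]. Qed.

Lemma colon_hideal J f k : hideal J -> f \is k.-homog -> hideal (colon J f).
Proof. by case=> idJ hJ fk; split; [exact: colon_ideal | exact: colon_homog fk]. Qed.

(** If f and g are outside p, let f_d and g_e be their lowest components outside
    p.  Modulo p, the component of degree d + e of f g is f_d g_e. *)
Lemma homog_prime p : hideal p -> ~ p 1 ->
  (forall d e f g, f \is d.-homog -> g \is e.-homog -> p (f * g) -> p f \/ p g) ->
  is_prime p.
Proof.
case=> idp hp p1 pM; split=> // f g pfg; apply: NNPP => /not_or_and[nf ng].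
have first f' : ~ p f' -> exists d, ~ p (pi d f') /\ forall e, (e < d)%N -> p (pi e f').
  move=> nf'; have [|d [nd dmin]] := @min_nat (fun d => ~ p (pi d f')).
    by apply: not_all_ex_not => pf'; apply: nf'; exact: homog_parts.
  by exists d; split=> // e ed; apply: NNPP; exact: dmin.
have [d [nd dmin]] := first f nf; have [e [ne emin]] := first g ng.
suff : p (pi d f * pi e g) by case/(pM _ _ _ _ (pihomogP _ _ _) (pihomogP _ _ _)).
pose N := maxn (msize f) d.+1; have ltN : (d < N)%N by rewrite leq_maxr.
have fE : f = \sum_(j < N) pi j f by exact/pihomog_partitionE/leq_maxl.
have := hp _ (d + e)%N pfg; rewrite mulrC [in X in p X]fE mulr_sumr raddf_sum /=.
rewrite (bigD1 (Ordinal ltN)) //= (pihomogM _ _ (pihomogP _ _ _)) leq_addr addKn.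
rewrite -[X in _ + X]opprK => /(ideal_subl idp) Jd; rewrite mulrC; apply: Jd.
apply: idealN => //. apply: ideal_sum => // j jd.
rewrite (pihomogM _ _ (pihomogP _ _ _)); case: leqP => [jde|_]; last exact: ideal0.
have [jd'|dj] := ltnP j d; first by apply: idealM => //; exact: dmin.
apply: (ideal_mulr idp); apply: emin.
have : (j : nat) != d by apply: contraNneq jd => e'; apply/eqP/val_inj.
by lia.
Qed.

(** An associated prime: a maximal element among the ideals J : f, for forms f
    outside J, is prime. *)
Lemma exists_prime_colon J : hideal J -> ~ J 1 ->
  exists f d, [/\ f \is d.-homog, ~ J f & is_prime (colon J f)].
Proof.
move=> hJ J1; have [idJ _] := hJ.
pose Q L := forall f d, f \is d.-homog -> ~ J f -> (forall x, L x <-> colon J f x) ->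
  exists f d, [/\ f \is d.-homog, ~ J f & is_prime (colon J f)].
suff : Q (colon J 1) by apply; [exact: dhomog1 | |].
apply: noetherian_ind (colon_ideal idJ 1) => L idL IH f d fd nf LE.
apply: NNPP => nprime; have hC := colon_hideal hJ fd.
apply/nprime; exists f, d; split=> //; apply: homog_prime => //.
  by rewrite /colon mul1r.
move=> d1 d2 g h gd hd gh; apply: NNPP => /not_or_and[ng nh]; apply: nprime.
apply: (IH (colon J (g * f)) (colon_ideal idJ _) _ _ (g * f) (d1 + d)%N) => //.
- by move=> x /LE; rewrite /colon => Jx; rewrite mulrCA; exact: idealM.
- by exists h; split; [rewrite /colon mulrA [h * g]mulrC | move/LE].
- exact: dhomogM.
Qed.

(** Every graded module P/J has a finite filtration with quotients P/p, for
    homogeneous primes p; read as an induction principle. *)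
Lemma devissage (Q : (P -> Prop) -> Prop) :
  (forall J, hideal J -> J 1 -> Q J) ->
  (forall J f d, hideal J -> f \is d.-homog -> hprime (colon J f) ->
     Q (add_gen J f) -> Q J) ->
  forall J, hideal J -> Q J.
Proof.
move=> Qtop Qstep J hJ; have [idJ homJ] := hJ; move: J idJ homJ {hJ}.
apply: noetherian_ind => J idJ IH homJ; have hJ := HIdeal idJ homJ.
have [|J1] := classic (J 1); first exact: Qtop.
have [f [d [fd nf fp]]] := exists_prime_colon hJ J1.
apply: (Qstep _ f d) => //; first by split=> //; exact: colon_homog fd.
apply: IH; [exact: add_gen_ideal | exact: sub_add_gen | | exact: add_gen_homog fd].
by exists f; split=> //; exact: mem_add_gen.
Qed.

Definition contains_vars J : Prop := forall i, J 'X_i.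

Lemma contains_vars_pos J f d : is_ideal J -> contains_vars J ->
  f \is d.-homog -> (0 < d)%N -> J f.
Proof.
move=> idJ iJ fd d0; rewrite (mpolyE f) big_seq; apply: ideal_sum => // m mf.
have md : mdeg m = d := dhomog_mf fd mf; rewrite mdegE in md.
have [i mi] : exists i, (0 < m i)%N.
  apply: NNPP => ni; move: d0; rewrite -md big1 // => i _; apply/eqP.
  by rewrite -leqn0 leqNgt; apply/negP => mi; apply: ni; exists i.
have -> : m = (m - U_(i) + U_(i))%MM by rewrite submK // lep1mP -lt0n.
by rewrite mpolyXD scalerAl; apply: idealM.
Qed.

Lemma homog_component J f g x d e : hideal J -> f \is d.-homog -> x \is (e + d).-homog ->
  J (x - g * f) -> J (x - pi e g * f).
Proof.
case=> idJ homJ fd xd /(homJ _ (e + d)%N).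
by rewrite raddfB /= (pihomogM _ _ fd) leq_addl addnK pihomog_dE.
Qed.

(** If all primes of a filtration of P/J contain the variables, then every layer,
    hence P/J, vanishes in large degrees. *)
Lemma eventually_zero_or_prime J : hideal J ->
  (exists N, forall d f, (N <= d)%N -> f \is d.-homog -> J f) \/
  (exists p, [/\ hprime p, (forall x, J x -> p x) & ~ contains_vars p]).
Proof.
apply: (devissage (Q := fun J => _ \/ _)) => {J} [J [idJ _] J1|J f d hJ fd fp].
  by left; exists 0%N => d f _ _; rewrite -(mulr1 f); exact: idealM.
have [idJ homJ] := hJ.
case=> [[N NP]|[p [pp Jp np]]]; last first.
  by right; exists p; split=> // x Jx; exact/Jp/sub_add_gen.
have [ic|] := classic (contains_vars (colon J f)); last first.
  by right; exists (colon J f); split=> // x; exact: sub_colon.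
left; exists (N + d).+1 => e x le xe.
have [g Jg] : add_gen J f x by apply: NP xe; lia.
have ee : (e - d + d = e)%N by lia.
rewrite -ee in xe; have Jx := homog_component hJ fd xe Jg.
apply: (ideal_subl idJ Jx); have [[idc _ _] _] := fp.
by apply: (contains_vars_pos idc ic (pihomogP mdeg (e - d) g)); lia.
Qed.

Definition lform (v : 'rV[K]_n.+1) : P := \sum_j v 0 j *: 'X_j.

Lemma lform_homog v : lform v \is 1.-homog.
Proof.
by apply: rpred_sum => j _; apply: rpredZ; rewrite dhomogX; exact/eqP/mdeg1.
Qed.

Lemma lform_linear : linear lform.
Proof.
move=> c u v; rewrite scaler_sumr -big_split /=; apply: eq_bigr => j _.
by rewrite !mxE scalerDl scalerA.
Qed.

HB.instance Definition _ := GRing.isLinear.Build K _ _ _ lform lform_linear.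

Lemma lformX i : lform (delta_mx 0 i) = 'X_i.
Proof.
rewrite /lform (bigD1 i) //= mxE !eqxx scale1r big1 ?addr0 // => j ji.
by rewrite mxE eqxx (negPf ji) scale0r.
Qed.

Hypothesis charK : [pchar K] =i pred0.

(** The set G consists of the linear forms L outside those primes p of a filtration
    of P/J that do not contain all variables.  If x L is in J and x has large
    degree, then x descends through the filtration into J: the layers P/p with L
    outside p have no L-torsion, and the other layers live in bounded degree.
    A prime q above J contains some p of the filtration; if q contains L but not
    all variables, then p is strictly smaller. *)
Lemma generic_linear_form J : hideal J -> exists G : 'rV[K]_n.+1 -> Prop,
  [/\ line_open G, exists v, G v,
     (forall v, G v -> exists N, forall d x, (N <= d)%N -> x \is d.-homog ->
        J (x * lform v) -> J x) &
     forall v q, G v -> hprime q -> (forall x, J x -> q x) ->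
       ~ contains_vars q -> q (lform v) ->
       exists p, [/\ hprime p, (forall x, J x -> p x), (forall x, p x -> q x)
                   & ~ p (lform v)]].
Proof.
apply: (devissage (Q := fun J => exists G, _)) => {J} [J [idJ _] J1|J f d hJ fd fp].
  exists (fun=> True); split=> //; first by move=> *; exists [::].
  - by exists 0.
  - by move=> v _; exists 0%N => d x _ _ _; rewrite -(mulr1 x); exact: idealM.
  - by move=> v q _ [[_ q1 _] _] Jq; case: q1; exact: Jq.
have [idJ homJ] := hJ; case=> G [oG neG GN Gp]; have [pp _] := fp; have [idc _ _] := pp.
exists (fun v => G v /\ (contains_vars (colon J f) \/ ~ colon J f (lform v))); split.
- apply: line_openI => //; have [ic|nc] := classic (contains_vars (colon J f)).
    by move=> u w _; exists [::] => t _; left.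
  have oC : line_open (fun v => ~ colon J f (lform v)).
    apply: line_open_subspace => c u v Ju Jv; rewrite lform_linear -mul_mpolyC.
    by apply: idealD => //; exact: idealM.
  by move=> u w [//|nu]; have [s sP] := oC u w nu; exists s => t /sP ?; right.
- have [ic|/not_all_ex_not[i ni]] := classic (contains_vars (colon J f)).
    by case: neG => v Gv; exists v; split; [|left].
  have [|||v [Gv nv]] := line_open_meet charK oG
      (_ : line_open (fun v => ~ colon J f (lform v))).
  + apply: line_open_subspace => c u v Ju Jv; rewrite lform_linear -mul_mpolyC.
    by apply: idealD => //; exact: idealM.
  + exact: neG.
  + by exists (delta_mx 0 i); rewrite lformX.
  by exists v; split; [|right].
- move=> v [/GN[N NP] vp]; exists (N + d).+1 => e x le xe Jx.
  have Jx' := sub_add_gen f Jx.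
  have [g Jg] : add_gen J f x.
    by apply: (NP e) => //; lia.
  have ee : (e - d + d = e)%N by lia.
  rewrite -ee in xe; have Jgf := homog_component hJ fd xe Jg.
  apply: (ideal_subl idJ Jgf); case: vp => [ic|ncv].
    by apply: (contains_vars_pos idc ic (pihomogP mdeg (e - d) g)); lia.
  suff : colon J f (pi (e - d) g * lform v) by case: pp => _ _ pM /pM[].
  have : J ((x - pi (e - d) g * f) * lform v) by apply: ideal_mulr.
  by rewrite mulrBl => /(ideal_subr idJ)/(_ Jx); rewrite /colon mulrAC.
- move=> v q [Gv vp] qp Jq nq qv; have [qf|nqf] := classic (q f).
    have [[idq _ _] _] := qp.
    have [|p [? Jp ? ?]] := Gp v q Gv qp _ nq qv; first exact: add_gen_sub.
    by exists p; split=> // x Jx; apply/Jp/sub_add_gen.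
  have cq x : colon J f x -> q x by move/Jq; case: qp => -[_ _ qM] _ /qM[].
  exists (colon J f); split=> //; first by move=> x; exact: sub_colon.
  by case: vp => // ic; case: nq => i; exact/cq/ic.
Qed.
End Devissage.

(** * Sections by linear forms *)

Section Sections.
Variables (K : fieldType) (n : nat).
Local Notation P := {mpoly K[n.+1]}.
Local Notation V := (dhomog n.+1 K).
Local Notation pi := (pihomog mdeg).
Implicit Types (J : P -> Prop) (B : 'M[K]_n.+1).

(** Rows are indexed by natural numbers, so that the number of sections can vary
    without casts between matrix types. *)
Definition row_form B (r : nat) : P := lform (row (inord r) B).

Fixpoint sect J B k : P -> Prop :=
  if k is k'.+1 then add_gen (sect J B k') (row_form B k') else J.

Lemma row_form_homog B r : row_form B r \is 1.-homog.
Proof. exact: lform_homog. Qed.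

Lemma sect_hideal J B k : hideal J -> hideal (sect J B k).
Proof. by move=> hJ; elim: k => //= k IH; exact: add_gen_hideal (row_form_homog B k). Qed.

Lemma sub_sect J B k x : J x -> sect J B k x.
Proof. by move=> Jx; elim: k => //= k; exact: sub_add_gen. Qed.

Lemma mem_sect J B k r : hideal J -> (r < k)%N -> sect J B k (row_form B r).
Proof.
move=> hJ; elim: k => // k IH; rewrite ltnS leq_eqVlt => /predU1P[->|/IH] /=.
  exact/mem_add_gen/hideal_ideal/sect_hideal.
exact: sub_add_gen.
Qed.

Lemma sect_sub J B k L : is_ideal L -> (forall x, J x -> L x) ->
  (forall r, (r < k)%N -> L (row_form B r)) -> forall x, sect J B k x -> L x.
Proof.
move=> idL JL; elim: k => [|k IH] Lk //=.
by apply: add_gen_sub => //; [apply: IH => r rk; apply: Lk; lia | exact: Lk].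
Qed.

Lemma eq_sect J B B' k : (forall r, (r < k)%N -> row_form B r = row_form B' r) ->
  sect J B k = sect J B' k.
Proof.
by elim: k => //= k IH e; rewrite e // IH // => r rk; apply: e; lia.
Qed.

Lemma ideal_gen_ideal (R : comNzRingType) (S : R -> Prop) : is_ideal (ideal_gen S).
Proof.
split.
- by exists [::]; rewrite ?big_nil.
- move=> _ _ [s sS ->] [s' sS' ->]; exists (s ++ s'); last by rewrite big_cat.
  by move=> x; rewrite mem_cat => /orP[/sS|/sS'].
- move=> r _ [s sS ->]; exists [seq (r * x.1, x.2) | x <- s].
    by move=> _ /mapP[x xs ->] /=; exact: sS.
  by rewrite mulr_sumr big_map; apply: eq_bigr => x _ /=; rewrite mulrA.
Qed.

Lemma mem_ideal_gen (R : comNzRingType) (S : R -> Prop) x : S x -> ideal_gen S x.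
Proof.
move=> Sx; exists [:: (1, x)]; last by rewrite big_seq1 mul1r.
by move=> y; rewrite inE => /eqP->.
Qed.

Lemma ideal_gen_sub (R : comNzRingType) (S L : R -> Prop) : is_ideal L ->
  (forall x, S x -> L x) -> forall x, ideal_gen S x -> L x.
Proof.
move=> idL SL _ [s sS ->]; rewrite big_seq; apply: ideal_sum => // x /sS/SL.
exact: idealM.
Qed.

Definition top_rows k B : 'M[K]_(k, n.+1) := \matrix_(r, j) B (inord r) j.

Lemma linear_form_top_rows k B (r : 'I_k) : linear_form (top_rows k B) r = row_form B r.
Proof. by apply: eq_bigr => j _; rewrite !mxE. Qed.

Section Ideal.
Variable I : idealr P.
Local Notation inI := (fun f : P => f \in I).

Lemma mem_is_ideal : is_ideal inI.
Proof.
split; [exact: rpred0 | move=> a b aI bI; exact: rpredD |].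
by move=> r a aI; apply: idealMr.
Qed.

Lemma section_ideal_ideal k (A : 'M[K]_(k, n.+1)) : is_ideal (section_ideal I A).
Proof.
have [g0 gD gM] := mem_is_ideal.
have [h0 hD hM] := ideal_gen_ideal (fun l => exists r, l = linear_form A r).
split; first by exists 0, 0; rewrite addr0.
  move=> _ _ [g [h [gI hA ->]]] [g' [h' [gI' hA' ->]]].
  by exists (g + g'), (h + h'); split; [exact: gD | exact: hD | rewrite addrACA].
move=> r _ [g [h [gI hA ->]]].
by exists (r * g), (r * h); split; [exact: gM | exact: hM | rewrite mulrDr].
Qed.

Lemma section_ideal_sect k B (f : P) : hideal inI ->
  section_ideal I (top_rows k B) f <-> sect inI B k f.
Proof.
move=> hI; have [idS _] := sect_hideal B k hI; split.
  case=> g [h [gI hA ->]]; apply: idealD => //; first exact: sub_sect.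
  move: h hA; apply: ideal_gen_sub => // _ [r ->]; rewrite linear_form_top_rows.
  exact: mem_sect.
apply: sect_sub; first exact: section_ideal_ideal.
  move=> x xI; exists x, 0; split=> //; last by rewrite addr0.
  exact: (ideal0 (ideal_gen_ideal _)).
move=> r rk; exists 0, (row_form B r); split; last by rewrite add0r.
  exact: rpred0.
by apply: mem_ideal_gen; exists (Ordinal rk); rewrite linear_form_top_rows.
Qed.

Lemma section_ideal_homog k (A : 'M[K]_(k, n.+1)) : hideal inI ->
  is_homog (section_ideal I A).
Proof.
case=> _ homI _ d [g [h [gI [s sS ->] ->]]]; rewrite raddfD /= raddf_sum /=.
apply: idealD; first exact: section_ideal_ideal.
  exists (pi d g), 0; split; [exact: homI | | by rewrite addr0].
  exact: (ideal0 (ideal_gen_ideal _)).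
rewrite big_seq; apply: ideal_sum; first exact: section_ideal_ideal.
move=> x /sS [r rE]; have x2 : x.2 \is 1.-homog.
  by rewrite rE; apply: rpred_sum => j _; apply: rpredZ; rewrite dhomogX; exact/eqP/mdeg1.
rewrite (pihomogM _ _ x2); case: ifP => _; last exact: (ideal0 (section_ideal_ideal A)).
exists 0, (pi (d - 1) x.1 * x.2); split; [exact: rpred0 | | by rewrite add0r].
by apply: idealM; [exact: ideal_gen_ideal | apply: mem_ideal_gen; exists r].
Qed.

(** An element of one section of I, written through the defining linear forms,
    moves along with these forms. *)
Lemma section_deform k (A0 : 'M[K]_(k, n.+1)) d (u : V d) : hideal inI ->
  section_ideal I A0 (val u) ->
  exists (u0 : V d) (c : 'I_k -> 'I_n.+1 -> V d),
    u = u0 + \sum_r \sum_j A0 r j *: c r j /\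
    forall A : 'M[K]_(k, n.+1), section_ideal I A (val (u0 + \sum_r \sum_j A r j *: c r j)).
Proof.
move=> hI [g [h [gI [s sS hE] uE]]].
have [q hq] : exists q : 'I_k -> P, h = \sum_r q r * linear_form A0 r.
  have idQ : is_ideal (fun h => exists q : 'I_k -> P, h = \sum_r q r * linear_form A0 r).
    split.
    - by exists (fun=> 0); rewrite big1 // => r _; rewrite mul0r.
    - move=> _ _ [q ->] [q' ->]; exists (fun r => q r + q' r).
      by rewrite -big_split; apply: eq_bigr => r _; rewrite mulrDl.
    - move=> x _ [q ->]; exists (fun r => x * q r).
      by rewrite mulr_sumr; apply: eq_bigr => r _; rewrite mulrA.
  rewrite hE big_seq; apply: (ideal_sum idQ) => x /sS[r ->].
  exists (fun i => if i == r then x.1 else 0).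
  rewrite (bigD1 r) //= eqxx big1 ?addr0 // => i /negPf ->; exact: mul0r.
pose c (r : 'I_k) (j : 'I_n.+1) : V d := DHomog (pihomogP mdeg d (q r * 'X_j)).
pose u0 : V d := DHomog (pihomogP mdeg d g).
have valE (A : 'M[K]_(k, n.+1)) : val (u0 + \sum_r \sum_j A r j *: c r j) =
    pi d (g + \sum_r q r * linear_form A r).
  rewrite !raddfD /= !raddf_sum /=; congr (_ + _); apply: eq_bigr => r _.
  rewrite raddf_sum mulr_sumr raddf_sum; apply: eq_bigr => j _ /=.
  by rewrite -scalerAr linearZ.
exists u0, c; split=> [|A]; last first.
  rewrite valE; apply: section_ideal_homog => //; exists g; eexists; split; [by []| |by[]].
  apply: ideal_sum => [|r _]; first exact: ideal_gen_ideal.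
  by apply: idealM; [exact: ideal_gen_ideal | apply: mem_ideal_gen; exists r].
by apply: val_inj; rewrite valE -hq -uE pihomog_dE //; exact: valP.
Qed.

(** The dimension takes its least value on a nonempty open set.  At a point A0 of
    least dimension, deform every vector of the section ideal with A and keep a
    complement fixed.  The resulting endomorphism M A of the space of forms is the
    identity at A0 and polynomial in A; where its determinant does not vanish, the
    section ideal is at least as large as at A0. *)
Lemma generic_section_dim_exists k d : hideal inI ->
  exists m, generic_section_dim I k d m.
Proof.
move=> hI; pose sd (A : 'M[K]_(k, n.+1)) := graded_quotient_dim (section_ideal I A) d.
have [|m [[A0 mE] mmin]] := @min_nat (fun m => exists A, sd A = m).
  by exists (sd 0), 0.
have idS (A : 'M[K]_(k, n.+1)) := section_ideal_ideal A.
pose N := dim (V d); pose U0 := degree_part (section_ideal I A0) d.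
(* The unit vector e i is split along U0 and a complement; only the part u i in U0
   is deformed, to ud i A. *)
pose e (i : 'I_N) : V d := @r2v K (V d) (delta_mx 0 i).
pose u i := projv U0 (e i).
have uS i : section_ideal I A0 (val (u i)) by apply/(mem_degree_part (idS A0))/memv_proj.
pose dfm i := constructive_indefinite_description _ (section_deform hI (uS i)).
pose u0 i := sval (dfm i).
pose dfm2 i := constructive_indefinite_description _ (svalP (dfm i)).
pose c i := sval (dfm2 i).
pose ud i (A : 'M[K]_(k, n.+1)) := u0 i + \sum_r \sum_j A r j *: c i r j.
have udE i : u i = ud i A0 by exact: (svalP (dfm2 i)).1.
have udS i A : section_ideal I A (val (ud i A)) by exact: (svalP (dfm2 i)).2.
pose M (A : 'M[K]_(k, n.+1)) : 'M[K]_N := \matrix_(i, l) v2r (ud i A + (e i - u i)) 0 l.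
pose MP : 'M[{mpoly K[k * n.+1]}]_N := \matrix_(i, l)
  ((v2r (u0 i + (e i - u i)) 0 l)%:MP
   + \sum_r \sum_j (v2r (c i r j) 0 l) *: 'X_(mxvec_index r j)).
have MPE A : (\det MP).@[fun t => mxvec A 0 t] = \det (M A).
  rewrite -det_map_mx; congr (\det _); apply/matrixP => i l.
  have split_ud : v2r (ud i A + (e i - u i)) 0 l =
      v2r (u0 i + (e i - u i)) 0 l + v2r (\sum_r \sum_j A r j *: c i r j) 0 l.
    by rewrite /ud addrAC linearD mxE.
  rewrite !mxE split_ud raddfD /= mevalC; congr (_ + _).
  rewrite raddf_sum linear_sum /= summxE; apply: eq_bigr => r _.
  rewrite raddf_sum linear_sum /= summxE; apply: eq_bigr => j _ /=.
  by rewrite mevalZ mevalXU mxvecE linearZ /= !mxE mulrC.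
exists m; exists (fun A => \det (M A) != 0); split.
- exists (fun F => F = \det MP) => A; split=> [nz|[F ->]]; last by rewrite MPE.
  by exists (\det MP); rewrite ?MPE.
- exists A0; suff -> : M A0 = 1%:M by rewrite det1 oner_eq0.
  by apply/matrixP => i l; rewrite !mxE -udE addrC subrK r2vK mxE eqxx eq_sym.
move=> A nz; apply/eqP; rewrite eqn_leq andbC leqNgt; apply/andP; split.
  by apply/negP => lt; apply: (mmin _ lt); exists A.
pose phi (v : V d) : V d := @r2v K (V d) (v2r v *m M A).
have philin : linear phi by move=> x y z; rewrite /phi linearP mulmxDl -scalemxAl linearP.
pose phiL := GRing.isLinear.Build _ _ _ _ phi philin.
pose phi' : {linear V d -> V d} := HB.pack phi phiL.
pose Phi := linfun phi'.
have PhiE v : Phi v = \sum_i v2r v 0 i *: (ud i A + (e i - u i)).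
  rewrite lfunE /= /phi; apply: (can_inj v2rK); rewrite r2vK linear_sum /=.
  apply/rowP => l; rewrite mxE summxE; apply: eq_bigr => i _.
  by rewrite linearZ /= !mxE.
have vE v : v = \sum_i v2r v 0 i *: e i.
  apply: (can_inj v2rK); rewrite linear_sum /= {1}[v2r v]row_sum_delta.
  by apply: eq_bigr => i _; rewrite linearZ /= r2vK.
have inj : (lker Phi == 0)%VS.
  apply/lker0P => x y; rewrite !lfunE /= /phi => /r2v_inj.
  have unM : M A \in unitmx by rewrite unitmxE unitfE.
  by move=> e0; apply: (can_inj v2rK); apply: (can_inj (mulmxK unM)); exact: e0.
have sub : (Phi @: U0 <= degree_part (section_ideal I A) d)%VS.
  apply/subvP => _ /memv_imgP[x xU ->]; apply/(mem_degree_part (idS A)).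
  have z : \sum_i v2r x 0 i *: (e i - u i) = 0.
    under eq_bigr do rewrite scalerBr.
    rewrite sumrB -vE; apply/eqP; rewrite subr_eq0 -{1}(projv_id xU) {1}(vE x).
    by rewrite linear_sum; apply/eqP/eq_bigr => i _; exact: linearZ.
  rewrite PhiE; under eq_bigr do rewrite scalerDr.
  rewrite big_split /= z addr0 raddf_sum; apply: ideal_sum => // i _ /=.
  by rewrite -mul_mpolyC; apply: idealM => //; exact: udS.
have := dimvS sub; rewrite limg_dim_eq; last by rewrite (eqP inj) capv0.
have := hfE d (idS A); have := hfE d (idS A0); rewrite -mE /sd /hf.
rewrite -/U0; set D := \dim fullv; move: D => D; move: (\dim _) (\dim _) => a b.
by lia.
Qed.

End Ideal.
End Sections.

(** * Choosing the sections, and persistence of the Hilbert function *)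

Section Choice.
Variables (K : fieldType) (charK : [pchar K] =i pred0) (n : nat).
Local Notation P := {mpoly K[n.+1]}.
Implicit Types (J : P -> Prop) (B : 'M[K]_n.+1).

(** On a line, a polynomial in the entries is a polynomial in one variable. *)
Lemma zariski_open_line_open k (U : 'M[K]_(k, n.+1) -> Prop) :
  zariski_open U -> line_open U.
Proof.
case=> S US u w /US[F SF Fu].
pose q : {poly K} := \sum_(m <- msupp F) F@_m *:
  \prod_i ((mxvec u 0 i)%:P + 'X * (mxvec (w - u) 0 i)%:P) ^+ m i.
have qE t : F.@[fun i => mxvec (u + t *: (w - u)) 0 i] = q.[t].
  rewrite mevalE horner_sum; apply: eq_bigr => m _; rewrite hornerZ horner_prod.
  congr (_ * _); apply: eq_bigr => i _; rewrite horner_exp !hornerE.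
  by rewrite linearD linearZ !mxE.
have [|s sP] := @root_list _ q.
  apply: contraNneq Fu => q0; rewrite -[u]addr0 -(scale0r (w - u)) qE q0 horner0 //.
by exists s => t ts; apply/US; exists F => //; rewrite qE; apply: contra ts => /sP.
Qed.

Lemma det_line_open : line_open (fun B => \det B != 0).
Proof.
apply: line_open_poly => u w.
exists (\det (map_mx polyC u + 'X *: map_mx polyC (w - u))) => t.
rewrite -horner_evalE -det_map_mx; congr (\det _); apply/matrixP => i j.
by rewrite !mxE /= horner_evalE !hornerE.
Qed.

Lemma top_rows_line_open k (U : 'M[K]_(k, n.+1) -> Prop) :
  line_open U -> line_open (fun B => U (top_rows k B)).
Proof.
by apply: line_open_affine => u w t; apply/matrixP => i j; rewrite !mxE.
Qed.

Lemma top_rows_surj k (A : 'M[K]_(k, n.+1)) : (k <= n.+1)%N -> exists B, top_rows k B = A.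
Proof.
move=> kn; exists (\matrix_(i, j) if insub (i : nat) is Some r then A r j else 0).
apply/matrixP => r j; rewrite !mxE inordK ?(leq_trans (ltn_ord r)) //.
by rewrite valK.
Qed.

Definition set_row B (r : nat) (v : 'rV[K]_n.+1) : 'M[K]_n.+1 :=
  \matrix_(i, j) if i == inord r then v 0 j else B i j.

Lemma row_form_set_row B r v : row_form (set_row B r v) r = lform v.
Proof. by apply: eq_bigr => j _; rewrite !mxE eqxx. Qed.

Lemma row_form_set_row_ne B r v s : (r <= n)%N -> (s < r)%N ->
  row_form (set_row B r v) s = row_form B s.
Proof.
move=> rn sr; apply: eq_bigr => j _; rewrite !mxE; case: eqP => // e.
have := congr1 val e; rewrite /= !inordK; lia.
Qed.

Lemma set_row_id B r : set_row B r (row (inord r) B) = B.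
Proof. by apply/matrixP => i j; rewrite !mxE; case: eqP => [->|]. Qed.

Definition filter_regular J (L : P) : Prop :=
  exists N, forall d x, (N <= d)%N -> x \is d.-homog -> J (x * L) -> J x.

(** Such an L never lies in a minimal homogeneous prime over J, except possibly
    in the irrelevant ideal. *)
Definition cuts_primes J (L : P) : Prop :=
  forall q, hprime q -> (forall x, J x -> q x) -> ~ contains_vars q -> q L ->
  exists p, [/\ hprime p, (forall x, J x -> p x), (forall x, p x -> q x) & ~ p L].

(** The rows are chosen one after the other: how the next row must be chosen
    depends on the earlier ones, and it is replaced without leaving U. *)
Lemma choose_sections J (U : 'M[K]_n.+1 -> Prop) D : hideal J -> line_open U ->
  (exists B, U B) -> (D <= n.+1)%N ->
  exists B, U B /\ forall r, (r < D)%N ->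
    filter_regular (sect J B r) (row_form B r) /\ cuts_primes (sect J B r) (row_form B r).
Proof.
move=> hJ oU neU; elim: D => [|D IH] Dn; first by case: neU => B UB; exists B.
have [|B [UB goodB]] := IH; first exact: ltnW.
have [G [oG neG GN Gp]] := generic_linear_form charK (sect_hideal B D hJ).
have oUB : line_open (fun v => U (set_row B D v)).
  apply: (line_open_affine (phi := set_row B D)) oU => u w t.
  by apply/matrixP => i j; rewrite !mxE; case: eqP => // _; rewrite subrr mulr0 addr0.
have [|v [Uv Gv]] := line_open_meet charK oUB oG _ neG.
  by exists (row (inord D) B); rewrite set_row_id.
have sectE r : (r <= D)%N -> sect J (set_row B D v) r = sect J B r.
  by move=> rD; apply: eq_sect => s sr; apply: row_form_set_row_ne; lia.
exists (set_row B D v); split=> // r; rewrite ltnS leq_eqVlt => /predU1P[->|rD].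
  by rewrite sectE // row_form_set_row; split; [exact: GN | move=> q; exact: Gp].
by rewrite sectE ?(ltnW rD) // row_form_set_row_ne //; exact: goodB.
Qed.
End Choice.

Section Persistence.
Variables (K : fieldType) (n : nat).
Local Notation P := {mpoly K[n.+1]}.
Local Notation pi := (pihomog mdeg).
Implicit Types J : P -> Prop.

Lemma var_decomp d (h : P) : h \is d.+1.-homog ->
  exists g : 'I_n.+1 -> P, (forall k, g k \is d.-homog) /\ h = \sum_k g k * 'X_k.
Proof.
move=> hd; rewrite (mpolyE h) big_seq.
apply: (big_ind (fun h : P => exists g : 'I_n.+1 -> P,
   (forall k, g k \is d.-homog) /\ h = \sum_k g k * 'X_k)).
- by exists (fun=> 0); split=> [k|]; [exact: rpred0 | rewrite big1 // => k _; rewrite mul0r].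
- move=> _ _ [g [gd ->]] [g' [gd' ->]]; exists (fun k => g k + g' k).
  split=> [k|]; first exact: rpredD.
  by rewrite -big_split; apply: eq_bigr => k _; rewrite mulrDl.
move=> m mh; have md : mdeg m = d.+1 := dhomog_mf hd mh.
have [i mi] : exists i, (0 < m i)%N.
  apply: NNPP => ni; suff : mdeg m = 0%N by rewrite md.
  rewrite mdegE big1 // => i _; apply/eqP.
  by rewrite -leqn0 leqNgt; apply/negP => mi; apply: ni; exists i.
have mE : m = (m - U_(i) + U_(i))%MM by rewrite submK // lep1mP -lt0n.
exists (fun k => if k == i then h@_m *: 'X_[m - U_(i)] else 0); split=> [k|].
  case: eqP => _; last exact: rpred0.
  apply: rpredZ; rewrite dhomogX; apply/eqP.
  by have := congr1 mdeg mE; rewrite mdegD mdeg1 md addn1 => -[].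
rewrite (bigD1 i) //= eqxx big1 ?addr0 => [|k /negPf->]; last by rewrite mul0r.
by rewrite -scalerAl -mpolyXD -mE.
Qed.

(** Generation in degrees at most e, in the stepwise form J_(d+1) = P_1 J_d for
    d >= e. *)
Definition generated_le J e : Prop := forall d f, (e <= d)%N -> f \is d.+1.-homog -> J f ->
  exists g : 'I_n.+1 -> P, (forall k, g k \is d.-homog /\ J (g k)) /\ f = \sum_k g k * 'X_k.

Lemma generated_leI (I : idealr P) e : generated_in_degree_le I e ->
  generated_le (fun f => f \in I) e.
Proof.
case=> S Sdeg IS d f ed fd /IS[s sS fE].
have SI x : S x -> x \in I by move=> Sx; apply/IS/mem_ideal_gen.
have : f = \sum_(x <- s) pi d.+1 (x.1 * x.2).
  by rewrite -(pihomog_dE fd) fE raddf_sum.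
rewrite big_seq => ->; apply: (big_ind (fun f : P => exists g : 'I_n.+1 -> P,
  (forall k, g k \is d.-homog /\ g k \in I) /\ f = \sum_k g k * 'X_k)).
- exists (fun=> 0); split=> [k|]; first by split; exact: rpred0.
  by rewrite big1 // => k _; rewrite mul0r.
- move=> _ _ [g [gd ->]] [g' [gd' ->]]; exists (fun k => g k + g' k).
  split=> [k|]; first by case: (gd k) (gd' k) => ? ? [? ?]; split; exact: rpredD.
  by rewrite -big_split; apply: eq_bigr => k _; rewrite mulrDl.
move=> x /sS Sx; have [dx dxe xd] := Sdeg _ Sx.
rewrite (pihomogM _ _ xd) ifT; last by lia.
have xE : (d.+1 - dx = (d - dx).+1)%N by lia.
have [|g [gd ->]] := @var_decomp (d - dx) (pi (d.+1 - dx) x.1).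
  by rewrite -xE; exact: pihomogP.
exists (fun k => g k * x.2); split=> [k|]; last first.
  by rewrite mulr_suml; apply: eq_bigr => k _; rewrite mulrAC.
split; last exact/idealMr/SI.
by have -> : d = (d - dx + dx)%N by [lia]; exact: dhomogM.
Qed.

Lemma generated_le_add_gen J e L : hideal J -> L \is 1.-homog -> (0 < e)%N ->
  generated_le J e -> generated_le (add_gen J L) e.
Proof.
move=> hJ L1 e0 gJ d f ed fd [h]; have [idJ _] := hJ.
have idA := add_gen_ideal idJ L.
rewrite -(addn1 d) in fd; move/(homog_component hJ L1 fd) => Jf.
have hd : pi d h \is d.-homog by exact: pihomogP.
have [|g [gP gE]] := gJ d _ ed _ Jf.
  by rewrite -(addn1 d); apply: rpredB => //; exact: dhomogM.
have [h' [hd' hE]] : exists g : 'I_n.+1 -> P, (forall k, g k \is d.-1.-homog) /\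
    pi d h = \sum_k g k * 'X_k by apply: var_decomp; rewrite prednK //; lia.
exists (fun k => g k + h' k * L); split=> [k|]; last first.
  rewrite -[f](subrK (pi d h * L)) gE {1}hE mulr_suml -big_split.
  by apply: eq_bigr => k _; rewrite mulrDl mulrAC.
case: (gP k) => gd Jg; split.
  apply: rpredD => //; have -> : d = (d.-1 + 1)%N by lia.
  exact: dhomogM.
apply: idealD => //; first exact: sub_add_gen.
by apply: idealM => //; exact: mem_add_gen.
Qed.

Lemma generated_le_sect J e (B : 'M[K]_n.+1) k : hideal J -> (0 < e)%N ->
  generated_le J e -> generated_le (sect J B k) e.
Proof.
move=> hJ e0 gJ; elim: k => //= k; apply: generated_le_add_gen => //.
  exact: sect_hideal.
exact: row_form_homog.
Qed.

Lemma dhomog_msize_le d (f : P) : f \is d.-homog -> (msize f <= d.+1)%N.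
Proof.
move=> fd; have [->|f0] := eqVneq f 0; first by rewrite msize0.
by rewrite -mlead_deg // ltnS leq_eqVlt (dhomog_mf fd (mlead_supp f0) : mdeg _ = _) eqxx.
Qed.

(** The linear extension of tau from the monomials of degree less than b; the bound
    makes the sum range over a fixed finite type, so that linearity is immediate. *)
Definition monomial_ext b (tau : 'X_{1..n.+1} -> P) (f : P) : P :=
  \sum_(m : 'X_{1..n.+1 < b}) f@_m *: tau m.

Lemma monomial_ext_linear b tau : linear (monomial_ext b tau).
Proof.
move=> c f g; rewrite scaler_sumr -big_split; apply: eq_bigr => m _ /=.
by rewrite mcoeffD mcoeffZ scalerDl scalerA.
Qed.
HB.instance Definition _ b tau := GRing.isLinear.Build K P P _
  (monomial_ext b tau) (monomial_ext_linear b tau).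

Lemma monomial_extX b tau m : (mdeg m < b)%N -> monomial_ext b tau 'X_[m] = tau m.
Proof.
move=> mb; rewrite /monomial_ext (bigD1 (BMultinom mb)) //= mcoeffX eqxx scale1r.
rewrite big1 ?addr0 // => m' ne; rewrite mcoeffX; case: eqP => [e|]; last by rewrite scale0r.
by case/eqP: ne; apply: val_inj.
Qed.

Section Step.
Variables (J : P -> Prop) (v : 'rV[K]_n.+1) (d : nat).
Hypothesis hJ : hideal J.
Local Notation L := (lform v).
Hypothesis surj : forall f, f \is d.+1.-homog -> add_gen J L f.
Hypothesis surj' : d = 0%N \/ forall f, f \is d.-homog -> add_gen J L f.
Hypothesis inj : forall x, x \is d.-homog -> J (x * L) -> J x.

Lemma divide_by_lform (e : nat) f : f \is e.+1.-homog -> add_gen J L f ->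
  exists u, u \is e.-homog /\ J (f - u * L).
Proof.
rewrite -(addn1 e) => fe [g] /(homog_component hJ (lform_homog v) fe) Jg.
by exists (pi e g); split=> //; exact: pihomogP.
Qed.

(** Here sk and sl are mu X_k / L and mu X_l / L.  If mu = u L modulo J, then they
    equal X_k u and X_l u by injectivity of L.  If mu = 1, the claim is the
    vanishing of X_l sk - X_k sl for X_k = sk L and X_l = sl L. *)
Lemma quotient_symmetric mu k l (sk sl : P) : mdeg mu = d ->
  sk \is d.-homog -> sl \is d.-homog ->
  J ('X_[mu] * 'X_k - sk * L) -> J ('X_[mu] * 'X_l - sl * L) ->
  J ('X_l * sk - 'X_k * sl).
Proof.
move=> mud skd sld Jk Jl; have [idJ _] := hJ.
have [d0|d_pos] := posnP d.
  have mu0 : mu = 0%MM by apply/eqP; rewrite -mdeg_eq0 mud d0.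
  rewrite mu0 mpolyX0 !mul1r in Jk Jl.
  have -> : 'X_l * sk - 'X_k * sl = ('X_l - sl * L) * sk - ('X_k - sk * L) * sl.
    by ring.
  by apply: idealB => //; exact: ideal_mulr.
case: surj' => [d0|surjd]; first by rewrite d0 in d_pos.
have mu_homog : ('X_[mu] : P) \is d.-homog by rewrite dhomogX; exact/eqP.
have [|u [ud Ju]] := @divide_by_lform d.-1 'X_[mu] _ (surjd _ mu_homog).
  by rewrite prednK.
have X1 i : ('X_i : P) \is 1.-homog by rewrite dhomogX; exact/eqP/mdeg1.
have dE : d = (1 + d.-1)%N by lia.
have reduce i s : s \is d.-homog -> J ('X_[mu] * 'X_i - s * L) -> J (s - 'X_i * u).
  move=> sd Js; apply: inj; first by apply: rpredB => //; rewrite dE; exact: dhomogM.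
  have -> : (s - 'X_i * u) * L = ('X_[mu] - u * L) * 'X_i - ('X_[mu] * 'X_i - s * L) by ring.
  by apply: idealB => //; exact: ideal_mulr.
have -> : 'X_l * sk - 'X_k * sl = 'X_l * (sk - 'X_k * u) - 'X_k * (sl - 'X_l * u) by ring.
by apply: idealB => //; apply: idealM => //; exact: reduce.
Qed.

(** The map psi below sends a form f of degree d + 2 to the class of f / L in P/J:
    on monomials, X_k m is sent to X_k (m / L).  By quotient_symmetric the choice of
    k does not matter modulo J, so psi sends X_k g to X_k (g / L), which is in J if
    g is.  Hence psi sends J into J, whereas psi (x L) = x modulo J. *)
Lemma injective_step :
  (forall f, f \is d.+2.-homog -> J f ->
     exists g : 'I_n.+1 -> P, (forall k, g k \is d.+1.-homog /\ J (g k)) /\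
                               f = \sum_k g k * 'X_k) ->
  forall x, x \is d.+1.-homog -> J (x * L) -> J x.
Proof.
move=> gen; have [idJ homJ] := hJ.
have sg_ex m : exists u : P, mdeg m = d.+1 -> u \is d.-homog /\ J ('X_[m] - u * L).
  have [md|nd] := eqVneq (mdeg m) d.+1; last by exists 0 => /eqP; rewrite (negPf nd).
  have mh : ('X_[m] : P) \is d.+1.-homog by rewrite dhomogX; exact/eqP.
  by have [u uP] := divide_by_lform mh (surj mh); exists u.
pose sg m := sval (constructive_indefinite_description _ (sg_ex m)).
have sgP m : mdeg m = d.+1 -> sg m \is d.-homog /\ J ('X_[m] - sg m * L).
  exact: svalP (constructive_indefinite_description _ (sg_ex m)).
pose theta := monomial_ext d.+2 sg.
pose tau (m : 'X_{1..n.+1}) :=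
  if [pick k | 0 < m k]%N is Some k then 'X_k * sg (m - U_(k))%MM else 0 : P.
pose psi := monomial_ext d.+3 tau.
have coefX (g : P) m : g \is d.+1.-homog -> mdeg m != d.+1 -> g@_m = 0.
  by move=> gd; apply: (dhomog_nemf_coeff gd).
have monE (g : P) : g \is d.+1.-homog -> g = \sum_(m : 'X_{1..n.+1 < d.+2}) g@_m *: 'X_[m].
  by move=> gd; rewrite [LHS](mpolywE (dhomog_msize_le gd)).
have tauP m k : mdeg m = d.+1 -> J (tau (m + U_(k))%MM - 'X_k * sg m).
  move=> md; rewrite /tau; case: pickP => [l|none]; last first.
    by have := none k; rewrite mnmDE mnm1E eqxx addn1.
  have [<-|kl] := eqVneq k l; first by rewrite addmK subrr => _; exact: ideal0.
  rewrite mnmDE mnm1E (negPf kl) addn0 => ml.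
  have mE : m = (m - U_(l) + U_(l))%MM by rewrite submK // lep1mP -lt0n.
  set mu := (m - U_(l))%MM in mE.
  have mud : mdeg mu = d.
    by have := congr1 mdeg mE; rewrite mdegD mdeg1 md addn1 => -[].
  have mukd : mdeg (mu + U_(k))%MM = d.+1 by rewrite mdegD mdeg1 mud addn1.
  have -> : (m + U_(k) - U_(l) = mu + U_(k))%MM 
    by rewrite {1}mE -addmA [(U_(l) + _)%MM]addmC addmA addmK.
  have [skd Jk] := sgP _ mukd; have [sld Jl] := sgP _ md.
  apply: (quotient_symmetric mud skd sld); first by rewrite -mpolyXD.
  by rewrite -mpolyXD -mE.
have thetaJ (g : P) : g \is d.+1.-homog -> J (g - theta g * L).
  move=> gd; rewrite {1}(monE g gd) /theta /monomial_ext mulr_suml -sumrB.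
  apply: ideal_sum => // m _; have [md|nd] := eqVneq (mdeg m) d.+1; last first.
    by rewrite coefX // !scale0r mul0r subrr; exact: ideal0.
  rewrite -scalerAl -scalerBr -mul_mpolyC; apply: idealM => //.
  exact: (sgP _ md).2.
have theta_homog (g : P) : g \is d.+1.-homog -> theta g \is d.-homog.
  move=> gd; apply: rpred_sum => m _; have [md|nd] := eqVneq (mdeg m) d.+1.
    exact/rpredZ/(sgP _ md).1.
  by rewrite coefX // scale0r; exact: rpred0.
have psiM k (g : P) : g \is d.+1.-homog -> J (psi (g * 'X_k) - 'X_k * theta g).
  move=> gd; rewrite {1}(monE g gd) mulr_suml /psi linear_sum.
  rewrite /theta /monomial_ext mulr_sumr -sumrB.
  apply: ideal_sum => // m _; have [md|nd] := eqVneq (mdeg m) d.+1; last first.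
    by rewrite coefX // !scale0r mul0r linear0 mulr0 subrr; exact: ideal0.
  rewrite -scalerAl -mpolyXD linearZ /= monomial_extX ?mdegD ?mdeg1 ?md ?addn1 //.
  rewrite -scalerAr -scalerBr -mul_mpolyC; apply: idealM => //.
  exact: tauP.
move=> x xd JxL.
have psi0 : J (psi (x * L)).
  have [|g [gP ->]] := gen (x * L) _ JxL.
    by rewrite -(addn1 d.+1); apply: dhomogM => //; exact: lform_homog.
  rewrite /psi linear_sum; apply: ideal_sum => // k _; have [gd Jg] := gP k.
  apply: (ideal_subl idJ (psiM k _ gd)); apply: idealM => //; apply: inj.
    exact: theta_homog.
  exact: (ideal_subr idJ (thetaJ _ gd)).
have psi1 : J (psi (x * L) - theta x * L).
  rewrite /lform mulr_sumr /psi linear_sum mulr_sumr -sumrB; apply: ideal_sum => // k _.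
  rewrite -scalerAr linearZ /= -scalerAr -scalerBr -mul_mpolyC [theta x * _]mulrC.
  by apply: idealM => //; exact: psiM.
by apply: (ideal_subl idJ (thetaJ _ xd)); exact: (ideal_subr idJ psi1).
Qed.

End Step.

(** Multiplication by the linear form is surjective on P/J from degree d0 on.
    The equality of dimensions makes it injective in degree d0, and injective_step
    carries this to all later degrees. *)
Lemma persistence J v d0 : hideal J -> generated_le J d0.+1 ->
  (forall f, f \is d0.+1.-homog -> add_gen J (lform v) f) ->
  d0 = 0%N \/ (forall f, f \is d0.-homog -> add_gen J (lform v) f) ->
  hf J d0.+1 = hf J d0 -> forall d, (d0 <= d)%N -> hf J d = hf J d0.
Proof.
move=> hJ gJ surj surj0 eqh; have [idJ homJ] := hJ; have L1 := lform_homog v.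
have idA := add_gen_ideal idJ (lform v); have idC := colon_ideal idJ (lform v).
have surjd d : (d0 <= d)%N -> forall f, f \is d.+1.-homog -> add_gen J (lform v) f.
  move=> /subnK <-; elim: (d - d0)%N => // k IH f /var_decomp[g [gd ->]].
  by apply: ideal_sum => // i _; apply: ideal_mulr => //; apply: IH.
have exactE d : (d0 <= d)%N -> hf J d.+1 = hf (colon J (lform v)) d.
  move=> le; rewrite -(addn1 d) (hf_exact _ idJ homJ L1) addn1.
  by have /(hf_eq0 _ idA) -> := surjd d le.
have injd d : (d0 <= d)%N -> forall x, x \is d.-homog -> J (x * lform v) -> J x.
  move=> /subnK <-; elim: (d - d0)%N => [|k IH].
    apply: (hf_le_eq idJ idC) => [x _ Jx|]; first exact: sub_colon.
    by rewrite add0n -exactE // eqh.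
  apply: (@injective_step _ _ (k + d0)) => //; first exact: surjd (leq_addl k d0).
    case: k {IH} => // k; right; exact: surjd (leq_addl k d0).
  by move=> f fd Jf; apply: gJ => //; lia.
move=> d /subnK <-; elim: (d - d0)%N => // k IH; rewrite addSn exactE ?leq_addl // -IH.
apply: hf_eq => // x xd; split=> [|Jx]; [exact: injd (leq_addl k d0) x xd | exact: sub_colon].
Qed.
End Persistence.

(** * Primes of a quotient ring *)

Section QuotientPrimes.
Variables (R : comNzRingType) (I : idealr R).
Local Notation Q := {ideal_quot I}.
Local Open Scope quotient_scope.

Lemma prime_preim (c : prime_idealr Q) : is_prime (fun f : R => \pi_Q f \in c).
Proof.
split; first split.
- by rewrite raddf0; exact: idealr0.
- by move=> a b ca cb; rewrite raddfD /=; apply: rpredD.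
- by move=> r a ca; rewrite rmorphM; apply: idealMr.
- by rewrite rmorph1 idealr1.
by move=> a b; rewrite rmorphM prime_idealrM => /orP.
Qed.

Lemma pi_preim (c : prime_idealr Q) f : f \in I -> \pi_Q f \in c.
Proof.
move=> fI; have -> : \pi_Q f = 0; last exact: idealr0.
by apply/eqP; rewrite -(raddf0 \pi_Q) -Quotient.idealrBE subr0.
Qed.

Lemma prime_push (p : R -> Prop) : is_prime p -> (forall x, x \in I -> p x) ->
  exists c : prime_idealr Q, forall f, \pi_Q f \in c <-> p f.
Proof.
move=> pp Ip; have [idp p1 pM] := pp.
pose S (q : Q) : bool := if excluded_middle_informative (p (repr q)) then true else false.
have SP q : S q <-> p (repr q) by rewrite /S; case: excluded_middle_informative.
have Spi f : S (\pi_Q f) <-> p f.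
  have d : p (repr (\pi_Q f) - f) by apply: Ip; rewrite Quotient.idealrBE reprK.
  by rewrite SP; split=> [/(ideal_subr idp d)|/(ideal_subl idp d)].
have Sid : idealr_closed S.
  split.
  - by rewrite -(raddf0 \pi_Q); apply/Spi; exact: ideal0.
  - by apply/negP; rewrite -(rmorph1 \pi_Q) => /Spi.
  - move=> x u v; rewrite -[x]reprK -[u]reprK -[v]reprK => /Spi pu /Spi pv.
    by rewrite -rmorphM -raddfD; apply/Spi; apply: idealD => //; exact: idealM.
have Spr : prime_idealr_closed S.
  move=> u v; rewrite -[u]reprK -[v]reprK -rmorphM => /Spi/pM[] ?; apply/orP.
    by left; apply/Spi.
  by right; apply/Spi.
pose m1 := isIdealr.Build Q S Sid; pose m2 := isPrimeIdealrClosed.Build Q S Spr.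
pose c : prime_idealr Q := HB.pack S m1 m2.
by exists c.
Qed.
End QuotientPrimes.

(** * Krull dimension *)

Lemma leq_expn2r m n e : (m <= n)%N -> (m ^ e <= n ^ e)%N.
Proof. by case: e => // e mn; rewrite leq_exp2r. Qed.

Section Krull.
Variables (K : fieldType) (n : nat).
Local Notation P := {mpoly K[n.+1]}.
Local Notation V := (dhomog n.+1 K).
Local Notation pi := (pihomog mdeg).
Implicit Types (J p q : P -> Prop) (B : 'M[K]_n.+1) (ps : nat -> P -> Prop).

Definition strict_chain e ps : Prop := forall j, (j < e)%N ->
  (forall x, ps j x -> ps j.+1 x) /\ exists x, ps j.+1 x /\ ~ ps j x.

Lemma strict_chain_sub e ps i j x : strict_chain e ps -> (i <= j <= e)%N ->
  ps i x -> ps j x.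
Proof.
move=> ch /andP[/subnK <-]; elim: (j - i)%N => // k IH ke /(IH (ltnW ke)).
exact: (ch _ ke).1.
Qed.

(** Going down: q contains the last form, so cuts_primes provides a strictly
    smaller prime over the section by one form less. *)
Lemma chain_from_sections J B c q : hideal J ->
  (forall r, (r < c)%N -> cuts_primes (sect J B r) (row_form B r)) ->
  hprime q -> (forall x, sect J B c x -> q x) -> ~ contains_vars q ->
  exists ps, [/\ forall j, (j <= c)%N -> hprime (ps j) /\ (forall x, J x -> ps j x),
                 strict_chain c ps & ps c = q].
Proof.
move=> hJ; elim: c q => [|c IH] q cut hq Jq nq.
  by exists (fun=> q); split.
have [idS _] := sect_hideal B c hJ.
have [||p [hp Jp pq np]] := cut c (ltnSn c) q hq _ nq.
- by move=> x Sx; apply: Jq; exact: sub_add_gen.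
- by apply: Jq; exact: mem_add_gen.
have nirr : ~ contains_vars p by move=> ip; apply: nq => i; apply/pq/ip.
have [r rc|ps [psP ch psc]] := IH p _ hp Jp nirr; first by apply: cut; lia.
exists (fun j => if (j <= c)%N then ps j else q); split=> [j jc|j jc|]; last by rewrite ltnn.
- case: ifP => [jc'|_]; first exact: psP.
  by split=> // x Jx; apply: Jq; exact: sub_sect.
rewrite ltnS in jc; rewrite jc; case: ltnP => [jc'|cj]; first exact: ch.
have -> : j = c by lia.
rewrite psc; split=> //; exists (row_form B c); split=> //.
by apply: Jq; exact: mem_add_gen.
Qed.

Definition irrelevant (f : P) : Prop := f.@[fun=> 0] = 0.

Lemma irrelevant_prime : is_prime irrelevant.
Proof.
split; first split; rewrite /irrelevant ?raddf0 //.
- by move=> a b fa fb; rewrite mevalD fa fb addr0.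
- by move=> r a fa; rewrite mevalM fa mulr0.
- by rewrite meval1 => /eqP; rewrite oner_eq0.
by move=> a b; rewrite mevalM => /eqP; rewrite mulf_eq0 => /orP[] /eqP; [left | right].
Qed.

Lemma irrelevant_vars : contains_vars irrelevant.
Proof. by move=> i; rewrite /irrelevant mevalXU. Qed.

(** A homogeneous prime contains no nonzero constant, so the components of its
    elements have positive degree. *)
Lemma hprime_sub_irrelevant p x : hprime p -> p x -> irrelevant x.
Proof.
move=> [[idp p1 _] homp] px; have [idm _ _] := irrelevant_prime.
apply: homog_parts => // d; have [->|d0] := posnP d; last first.
  exact: contains_vars_pos idm irrelevant_vars (pihomogP mdeg d x) d0.
have := homp _ 0%N px; set c := pi 0 x.
have cE : c = (c@_0)%:MP.
  by apply: msize1_polyC; exact: dhomog_msize_le (pihomogP mdeg 0 x).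
have [c0|c0] := eqVneq c@_0 0; first by rewrite cE c0 mpolyC0 => _; exact: ideal0.
move=> pc; case: p1; rewrite -mpolyC1 -(mulVf c0) mpolyCM -cE.
exact: idealM.
Qed.

Lemma chain_to_irrelevant J B c : hideal J ->
  (forall r, (r < c)%N -> cuts_primes (sect J B r) (row_form B r)) ->
  (exists q, [/\ hprime q, forall x, sect J B c x -> q x & ~ contains_vars q]) ->
  exists ps, [/\ forall j, (j <= c.+1)%N -> is_prime (ps j) /\ (forall x, J x -> ps j x)
               & strict_chain c.+1 ps].
Proof.
move=> hJ cut [q [hq Jq nq]].
have [ps [psP ch psc]] := chain_from_sections hJ cut hq Jq nq.
exists (fun j => if (j <= c)%N then ps j else irrelevant); split=> j jc.
  case: ifP => [jc'|_]; first by case: (psP _ jc') => -[].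
  split; first exact: irrelevant_prime.
  by move=> x Jx; apply: hprime_sub_irrelevant hq _; apply: Jq; exact: sub_sect.
rewrite ltnS in jc; rewrite jc; case: ltnP => [jc'|cj]; first exact: ch.
have -> : j = c by lia.
rewrite psc; split=> [x qx|]; first exact: hprime_sub_irrelevant hq qx.
have /not_all_ex_not[i ni] := nq; exists 'X_i; split=> //; exact: irrelevant_vars.
Qed.

(** Monomials in elements f_j of ps (j+1) \ ps j are linearly independent modulo
    ps 0: in a relation, divide by the power of f_0 common to all terms, which is
    allowed modulo the prime ps 0, and reduce modulo ps 1. *)
Lemma chain_independent e a ps (f : nat -> P) :
  (forall j, (j <= e)%N -> is_prime (ps j)) -> strict_chain e ps ->
  (forall j, (j < e)%N -> [/\ ps j.+1 (f j), ~ ps j (f j) & msize (f j) <= a.+1])%N ->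
  forall N, exists (T : finType) (g : T -> P),
    [/\ #|T| = (N.+1 ^ e)%N, forall t, (msize (g t) <= (e * a * N).+1)%N &
        forall c : T -> K, ps 0%N (\sum_t c t *: g t) -> forall t, c t = 0].
Proof.
move=> + + + N; elim: e ps f => [|e IH] ps f pP ch fP.
  exists unit, (fun=> 1); split; first by rewrite card_unit.
    by move=> _; rewrite msize1.
  move=> c; rewrite (bigD1 tt) //= big1 => [|[]] //; rewrite addr0 => pc [].
  have [//|c0] := eqVneq (c tt) 0; case: (pP 0%N isT) => idp [].
  rewrite -(scale1r 1) -(mulVf c0) -scalerA -mul_mpolyC; exact: idealM.
have [|||T [g [cT sg gP]]] := IH (fun j => ps j.+1) (fun j => f j.+1).
- by move=> j je; apply: pP.
- by move=> j je; apply: ch.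
- by move=> j je; apply: fP.
have [f1 nf0 fa] := fP 0%N (ltn0Sn e).
have f0 : f 0%N != 0.
  by apply/eqP => f0; apply: nf0; rewrite f0; case: (pP 0%N isT) => idp _ _; exact: ideal0.
have bnd (x y u w : nat) : (x <= u.+1 -> y <= w.+1 -> (x + y).-1 <= (u + w).+1)%N by lia.
have sfX s : (msize (f 0%N ^+ s) <= (a * s).+1)%N.
  elim: s => [|s IHs]; first by rewrite expr0 msize1.
  by rewrite exprS msizeM ?expf_neq0 // mulnS; exact: bnd fa IHs.
exists ('I_N.+1 * T)%type, (fun st => f 0%N ^+ (st.1 : 'I_N.+1) * g st.2); split.
- by rewrite card_prod card_ord cT expnS.
- move=> [s t] /=; have [->|g0] := eqVneq (g t) 0; first by rewrite mulr0 msize0.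
  rewrite msizeM ?expf_neq0 //; apply: leq_trans (bnd _ _ _ _ (sfX s) (sg t)) _.
  by rewrite ltnS mulSn mulnDl leq_add2r leq_mul2l -ltnS ltn_ord orbT.
move=> c pc.
have [id0 n0 p0M] := pP 0%N isT; have [id1 _ _] := pP 1%N isT.
(* Collect the relation by powers of f 0: h s is the coefficient of (f 0)^s. *)
pose h (s : 'I_N.+1) := \sum_t c (s, t) *: g t.
have sumE : \sum_t c t *: (f 0%N ^+ (t.1 : 'I_N.+1) * g t.2) =
    \sum_(s < N.+1) f 0%N ^+ s * h s.
  under [RHS]eq_bigr do rewrite mulr_sumr.
  by rewrite pair_bigA; apply: eq_bigr => -[s t] _ /=; rewrite scalerAr.
rewrite sumE in pc.
suff row (s : nat) (sN : (s < N.+1)%N) : forall t, c (Ordinal sN, t) = 0.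
  by move=> [[s sN] t]; exact: row.
elim/ltn_ind: s sN => s IHs sN; apply: gP => /=.
have lowz (s' : 'I_N.+1) : (s' < s)%N -> h s' = 0.
  case: s' => s' s'N /= lt; rewrite /h big1 // => t _.
  by rewrite IHs // scale0r.
have hP : ps 0%N (\sum_(s' < N.+1 | (s <= s')%N) f 0%N ^+ (s' - s) * h s').
  suff : ps 0%N (f 0%N ^+ s * \sum_(s' < N.+1 | (s <= s')%N) f 0%N ^+ (s' - s) * h s').
    case/p0M => // /[dup] pf _; exfalso; elim: s pf {IHs sN lowz} => [|s IHs].
      by rewrite expr0.
    by rewrite exprS => /p0M[].
  rewrite mulr_sumr; move: pc; rewrite (bigID (fun s' : 'I_N.+1 => s <= s')%N) /=.
  rewrite [X in _ + X]big1 ?addr0; last first.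
    by move=> s'; rewrite -ltnNge => /lowz ->; rewrite mulr0.
  congr (ps _ _); apply: eq_bigr => s' le.
  by rewrite mulrA -exprD subnKC.
move: hP; rewrite (bigD1 (Ordinal sN)) //= subnn expr0 mul1r.
move/((ch 0%N isT).1); rewrite -[X in _ + X]opprK => /(ideal_subl id1); apply.
apply: idealN => //; apply: ideal_sum => // s' /andP[le ne].
have -> : (s' - s = (s' - s).-1.+1)%N.
  have : (s' : nat) != s by apply: contraNneq ne => e'; apply/eqP/val_inj.
  by lia.
by rewrite exprS -mulrA; exact: ideal_mulr.
Qed.

(** The subspace U is cut out by codim U linear conditions. *)
Lemma dim_preim (W X : vectType K) (phi : 'Hom(W, X)) (E : {vspace W}) (U : {vspace X}) :
  (\dim E + \dim U <= \dim (E :&: phi @^-1: U) + \dim {:X})%N.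
Proof.
set F := (E :&: phi @^-1: U)%VS.
have kerF : (F :&: lker phi = E :&: lker phi)%VS.
  apply/vspaceP => w; rewrite !memv_cap; case: (w \in E) => //=.
  case: (boolP (w \in lker phi)); rewrite ?andbF ?andbT // memv_ker => /eqP w0.
  by rewrite -memv_preim w0 mem0v.
have imF : (phi @: F = phi @: E :&: U)%VS.
  apply/vspaceP => x; rewrite memv_cap; apply/memv_imgP/andP.
    case=> w; rewrite memv_cap -memv_preim => /andP[wE wU] ->.
    by split=> //; exact: memv_img.
  case=> /memv_imgP[w wE ->] wU; exists w => //.
  by rewrite memv_cap wE -memv_preim.
have e1 := limg_ker_dim phi E; have e2 := limg_ker_dim phi F.
have e3 := dimv_sum_cap (phi @: E) U; have e4 := dimvS (subvf (phi @: E + U)).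
rewrite kerF in e2; rewrite imF in e2.
have count (k dE dF fE u fEU t s : nat) : (k + fE = dE)%N -> (k + fEU = dF)%N ->
    (s + fEU = fE + u)%N -> (s <= t)%N -> (dE + u <= dF + t)%N by lia.
exact: count e1 e2 e3 e4.
Qed.

(** In each degree k, membership in J imposes at most hf J k linear conditions on
    the coefficients. *)
Lemma hf_relation J m N (g : 'I_m -> P) : hideal J ->
  (forall t, msize (g t) <= N)%N -> (\sum_(k < N) hf J k < m)%N ->
  exists c : 'I_m -> K, (exists t, c t != 0) /\ J (\sum_t c t *: g t).
Proof.
case=> idJ homJ gN lt.
(* E: the coefficient vectors whose combination is in J in all degrees below N. *)
have [E [EP dE]] : exists E : {vspace 'rV[K]_m},
    (forall c, c \in E -> forall k, (k < N)%N -> J (pi k (\sum_t c 0 t *: g t))) /\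
    (m <= \dim E + \sum_(k < N) hf J k)%N.
  elim: N {gN lt} => [|N [E [EP dE]]].
    by exists fullv; split=> //; rewrite dimvf /dim /= mul1n big_ord0 addn0.
  pose phi (c : 'rV[K]_m) : V N := DHomog (pihomogP mdeg N (\sum_t c 0 t *: g t)).
  have phi_lin : linear phi.
    move=> x u v; apply: val_inj; rewrite /= -linearP; congr (pi N _).
    rewrite scaler_sumr -big_split; apply: eq_bigr => t _ /=.
    by rewrite !mxE scalerDl scalerA.
  pose phiL := GRing.isLinear.Build _ _ _ _ phi phi_lin.
  pose phi' : {linear 'rV[K]_m -> V N} := HB.pack phi phiL.
  exists (E :&: linfun phi' @^-1: degree_part J N)%VS; split.
    move=> c; rewrite memv_cap -memv_preim lfunE => /andP[cE /(mem_degree_part idJ) cJ] k.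
    rewrite ltnS leq_eqVlt => /predU1P[->//|]; exact: EP.
  rewrite big_ord_recr /=; have dp := dim_preim (linfun phi') E (degree_part J N).
  have dh := hfE N idJ.
  have count (u e t x h s : nat) : (e + u <= x + t)%N -> (h + u = t)%N ->
    (m <= e + s)%N -> (m <= x + (s + h))%N by lia.
  exact: count dp dh dE.
have : (vpick E) != 0 by rewrite vpick0 -dimv_eq0 -lt0n; lia.
move=> v0; exists (fun t => vpick E 0 t); split.
  apply: NNPP => nt; case/eqP: v0; apply/rowP => t; rewrite mxE; apply/eqP.
  by apply: contraT => t0; case: nt; exists t.
apply: homog_parts => // k; have [kN|Nk] := ltnP k N; first exact: EP (memv_pick E) _ kN.
suff -> : pi k (\sum_t vpick E 0 t *: g t) = 0 by exact: ideal0.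
rewrite linear_sum big1 // => t _; rewrite linearZ /= pihomogE big_seq_cond big1 ?scaler0 //.
move=> mm /andP[mg /eqP mk]; have := msize_mdeg_lt mg; have := gN t.
by rewrite (mk : mdeg mm = k); lia.
Qed.

(** For S' = S + (L), hf_exact and the inclusion of S in S : L bound hf S by the
    partial sums of hf S'; so each section that is undone raises the exponent of
    the growth by one. *)
Lemma hf_growth J B c d0 : hideal J ->
  (forall d, (d0 <= d)%N -> hf (sect J B c) d = 0%N) ->
  exists C, forall N, (\sum_(k < N) hf J k <= C * N ^ c)%N.
Proof.
move=> hJ hf0.
suff H j : (j <= c)%N -> exists C, forall N,
    (\sum_(k < N) hf (sect J B (c - j)) k <= C * N ^ j)%N.
  by have [C CP] := H c (leqnn c); exists C => N; have := CP N; rewrite subnn.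
elim: j => [_|j IH jc].
  exists (\sum_(k < d0) hf (sect J B c) k)%N => N; rewrite subn0 expn0 muln1.
  have [Nd|dN] := leqP N d0.
    by rewrite -(subnKC Nd) big_split_ord /= leq_addr.
  rewrite -(subnKC (ltnW dN)) big_split_ord /= [X in (_ + X)%N]big1 ?addn0 // => k _.
  by apply: hf0; rewrite leq_addr.
have [C CP] := IH (ltnW jc).
have cE : (c - j = (c - j.+1).+1)%N by lia.
set S := sect J B (c - j.+1); have hS : hideal S by exact: sect_hideal.
set S' := sect J B (c - j) in CP; have S'E : S' = add_gen S (row_form B (c - j.+1)).
  by rewrite /S' cE.
have [idS homS] := hS; have idS' : is_ideal S' by rewrite S'E; exact: add_gen_ideal.
have L1 := row_form_homog B (c - j.+1).
have step d : (hf S d <= \sum_(k < d.+1) hf S' k)%N.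
  elim: d => [|d IHd].
    rewrite big_ord1; apply: hf_le => // f f0; rewrite S'E => -[g /(homS _ 0%N)].
    by rewrite raddfB /= (pihomogM _ _ L1) subr0 pihomog_dE.
  rewrite big_ord_recr /= -{1}(addn1 d) (hf_exact _ idS homS L1) addn1 -S'E addnC.
  rewrite leq_add2r (leq_trans _ IHd) //.
  by apply: hf_le => //; [exact: colon_ideal | move=> f _; exact: sub_colon].
exists C => N; apply: (@leq_trans (\sum_(k < N) C * N ^ j)%N); last first.
  by rewrite sum_nat_const card_ord expnS mulnCA.
apply: leq_sum => k _; apply: leq_trans (step k) _; apply: leq_trans (CP _) _.
by rewrite leq_mul2l leq_expn2r ?ltn_ord ?orbT.
Qed.

(** The (N + 1)^e products of powers of the f_j with exponents at most N are
    independent modulo J and have degree at most e a N, where hf_growth leaves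
    room for C (e a N + 1)^c of them only. *)
Lemma chain_length J B c d0 e ps : hideal J ->
  (forall d, (d0 <= d)%N -> hf (sect J B c) d = 0%N) ->
  (forall j, (j <= e)%N -> is_prime (ps j)) -> (forall x, J x -> ps 0%N x) ->
  strict_chain e ps -> (e <= c)%N.
Proof.
move=> hJ hf0 pP Jp ch; have [C CP] := hf_growth hJ hf0.
have pick_ex j : exists x : P, (j < e)%N -> ps j.+1 x /\ ~ ps j x.
  have [je|] := ltnP j e; last by exists 0.
  by have [_ [x xP]] := ch j je; exists x.
pose f j := sval (constructive_indefinite_description _ (pick_ex j)).
have fP j : (j < e)%N -> ps j.+1 (f j) /\ ~ ps j (f j).
  exact: svalP (constructive_indefinite_description _ (pick_ex j)).
pose a := (\max_(j < e) msize (f j))%N.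
have fa j : (j < e)%N -> [/\ ps j.+1 (f j), ~ ps j (f j) & (msize (f j) <= a.+1)%N].
  move=> je; have [? ?] := fP j je; split=> //; apply: leqW.
  exact: (leq_bigmax (F := fun j : 'I_e => msize (f j)) (Ordinal je)).
have bound N : (N.+1 ^ e <= C * (e * a * N).+1 ^ c)%N.
  have [T [g [cT sg gP]]] := chain_independent pP ch fa N.
  rewrite -cT leqNgt; apply/negP => lt.
  have [cc [[t ct] Jc]] := hf_relation (g := fun t : 'I_#|T| => g (enum_val t)) hJ
      (fun t => sg (enum_val t)) (leq_ltn_trans (CP _) lt).
  case/eqP: ct; rewrite -(enum_valK t); apply: (gP (fun t => cc (enum_rank t))).
  apply: Jp; rewrite (reindex (@enum_val T T)) /=; last first.
    by apply: onW_bij; exact: enum_val_bij.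
  by under eq_bigr do rewrite enum_valK.
rewrite leqNgt; apply/negP => ce.
(* Taking N = A, the constant of the bound (N + 1)^e <= A (N + 1)^c, forces e <= c. *)
have [A AE] : exists A, A = (C * (e * a).+1 ^ c)%N by eexists.
have le1 : (A.+1 ^ e <= A * A.+1 ^ c)%N.
  apply: leq_trans (bound A) _; rewrite {2}AE -(mulnA C) leq_mul2l -expnMn.
  apply/orP; right.
  by apply: leq_expn2r; nia.
have le2 : (A.+1 ^ c.+1 <= A.+1 ^ e)%N by rewrite leq_pexp2l.
have := leq_trans le2 le1; rewrite expnS leq_pmul2r ?expn_gt0 //.
by rewrite ltnn.
Qed.

Lemma krull_dim_of_sections (I : idealr P) B c d0 : hideal (fun f => f \in I) ->
  (forall r, (r < c)%N ->
     cuts_primes (sect (fun f => f \in I) B r) (row_form B r)) ->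
  (exists q, [/\ hprime q, forall x, sect (fun f => f \in I) B c x -> q x
              & ~ contains_vars q]) ->
  (forall d, (d0 <= d)%N -> hf (sect (fun f => f \in I) B c.+1) d = 0%N) ->
  has_krull_dim {ideal_quot I} c.+1.
Proof.
move=> hI cut top hf0; split.
  have [ps [psP ch]] := chain_to_irrelevant hI cut top.
  have push (j : 'I_c.+2) := prime_push (psP j (ltn_ord j)).1 (psP j (ltn_ord j)).2.
  pose C j := sval (constructive_indefinite_description _ (push j)).
  have CP j : forall f, (\pi_({ideal_quot I}) f)%qT \in C j <-> ps j f.
    exact: svalP (constructive_indefinite_description _ (push j)).
  exists C => i j ij; split.
    move=> x; rewrite -[x]reprK => /CP px; apply/CP.
    by apply: (strict_chain_sub ch) px; have := ltn_ord j; lia.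
  move=> sub; have [|_ [x [px nx]]] := ch i; first by have := ltn_ord j; lia.
  apply: nx; apply/CP/sub/CP; apply: (strict_chain_sub ch) px.
  by have := ltn_ord j; lia.
move=> e C ch; pose ps j (f : P) := (\pi_({ideal_quot I}) f)%qT \in C (inord j).
apply: (@chain_length (fun f => f \in I) B c.+1 d0 e ps) => //.
- by move=> j _; exact: prime_preim.
- by move=> x xI; exact: pi_preim.
move=> j je; have [|sub nsub] := ch (inord j) (inord j.+1).
  by rewrite !inordK //; lia.
split=> [x|]; first exact: sub.
apply: NNPP => nx; apply: nsub => x; rewrite -[x]reprK => xC.
by apply: NNPP => nxC; apply: nx; exists (repr x).
Qed.
End Krull.

(** * Hilbert series and multiplicity *)

Section HilbertSeries.
Implicit Types (a b k : nat -> int) (h q : {poly int}).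

(** The power series with coefficients a equals h(t) / (1 - t)^D. *)
Definition series_eq a h D : Prop := forall d,
  \sum_(j < d.+1) ((1 - 'X : {poly int}) ^+ D)`_j * a (d - j)%N = h`_d.

(** The hypotheses say that (1 - t) a(t) = b(t) - t k(t) with k a polynomial. *)
Lemma series_eq_step a b k h q D :
  a 0%N = b 0%N -> (forall d, a d.+1 = a d + b d.+1 - k d) -> (forall d, k d = q`_d) ->
  series_eq b h D -> series_eq a (h - (1 - 'X) ^+ D * ('X * q)) D.+1.
Proof.
move=> a0 aS kq bh d; pose A := \poly_(j < d.+1) a j; pose Bp := \poly_(j < d.+1) b j.
have convE (f : nat -> int) (p : {poly int}) :
    \sum_(j < d.+1) p`_j * f (d - j)%N = (p * \poly_(j < d.+1) f j)`_d.
  by rewrite coefM; apply: eq_bigr => j _; rewrite coef_poly ltnS leq_subr.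
rewrite convE coefB -bh convE -/A -/Bp exprSr -mulrA -coefB -mulrBr.
rewrite [LHS]coefM [RHS]coefM; apply: eq_bigr => j _; congr (_ * _).
rewrite mulrBl mul1r !coefB !coefXM !coef_poly.
case E: (d - j)%N => [|e] /=; first by rewrite a0.
have [e1 e2] : (e < d.+1)%N /\ (e.+1 < d.+1)%N by lia.
by rewrite e1 e2 aS kq; ring.
Qed.

Lemma series_eq_const a d0 m : (forall d, (d0 <= d)%N -> a d = m) ->
  exists2 h, h.[1] = m & series_eq a h 1.
Proof.
move=> am; (* The first differences of a vanish above d0 and sum up to a d0. *)
pose b d := if d is e.+1 then a d - a e else a d.
have b0 d : (d0 < d)%N -> b d = 0.
  by case: d => // e; rewrite ltnS => le; rewrite /b !am ?subrr // ltnW.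
pose h := \poly_(d < d0.+1) b d.
have bh : series_eq b h 0.
  move=> d; rewrite expr0 (bigD1 ord0) //= coef1 eqxx mul1r subn0 big1 ?addr0.
    by rewrite coef_poly ltnS; case: leqP => // /b0.
  by move=> j j0; rewrite coef1 (_ : (j : nat) == 0 = false)%N ?mul0r //; apply/negbTE.
exists (h - (1 - 'X) ^+ 0 * ('X * 0)); last first.
  apply: (series_eq_step (b := b) (k := fun=> 0)) bh => //.
    by move=> d; rewrite subr0 /b addrC subrK.
  by move=> d; rewrite coef0.
rewrite !mulr0 subr0 horner_poly -(am d0) //.
under eq_bigr do rewrite expr1n mulr1.
elim: (d0) => [|d IH]; first by rewrite big_ord1.
by rewrite big_ord_recr IH /= addrC subrK.
Qed.
End HilbertSeries.

Section Main.
Variables (K : fieldType) (n : nat).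
Local Notation P := {mpoly K[n.+1]}.
Implicit Types (J : P -> Prop) (B : 'M[K]_n.+1).

(** Let k d be the dimension of the kernel of multiplication by L on P/S in degree
    d.  By filter-regularity k is a polynomial, and its contribution to the
    numerator is a multiple of 1 - t, so the value at 1 stays m. *)
Lemma series_of_sections J B c d0 m : hideal J ->
  (forall r, (r < c)%N -> filter_regular (sect J B r) (row_form B r)) ->
  (forall d, (d0 <= d)%N -> hf (sect J B c) d = m) ->
  exists2 h : {poly int}, h.[1] = m%:Z & series_eq (fun d => (hf J d)%:Z) h c.+1.
Proof.
move=> hJ reg hfm.
suff H j : (j <= c)%N -> exists2 h : {poly int}, h.[1] = m%:Z &
    series_eq (fun d => (hf (sect J B (c - j)) d)%:Z) h j.+1.
  by have [h h1 hs] := H c (leqnn c); exists h => //; move: hs; rewrite subnn.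
elim: j => [_|j IH jc].
  by apply: (@series_eq_const _ d0) => d d0d; rewrite subn0 hfm.
have [h h1] := IH (ltnW jc).
have cE : (c - j = (c - j.+1).+1)%N by lia.
rewrite cE /=; set S := sect J B (c - j.+1); set L := row_form B (c - j.+1) => hs.
have hS : hideal S by exact: sect_hideal.
have [idS homS] := hS; have L1 : L \is 1.-homog by exact: row_form_homog.
have idC := colon_ideal idS L.
pose k d : int := (hf S d)%:Z - (hf (colon S L) d)%:Z.
have [N NP] : filter_regular S L by apply: reg; lia.
have k0 d : (N <= d)%N -> k d = 0.
  move=> Nd; rewrite /k (@hf_eq _ _ (colon S L) S) ?subrr // => x xd.
  by split=> [|/sub_colon]; [exact: NP Nd xd | apply].
exists (h - (1 - 'X) ^+ j.+1 * ('X * \poly_(d < N) k d)).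
  by rewrite hornerD hornerN hornerM horner_exp !hornerE subrr expr0n /= mul0r subr0.
apply: (series_eq_step (b := fun d => (hf (add_gen S L) d)%:Z) (k := k)) => //.
- congr (Posz _); apply: hf_eq => //; first exact: add_gen_ideal.
  move=> f f0; split=> [|[g /(homS _ 0%N)]]; first exact: sub_add_gen.
  by rewrite raddfB /= (pihomogM _ _ L1) subr0 pihomog_dE.
- move=> d; rewrite -{1}(addn1 d) (hf_exact d idS homS L1) addn1 PoszD /k; ring.
- by move=> d; rewrite coef_poly; case: ltnP => // /k0.
Qed.

(** The rows of an invertible matrix span all linear forms. *)
Lemma invertible_sections_vars J B : hideal J -> \det B != 0 -> contains_vars (sect J B n.+1).
Proof.
move=> hJ detB k; have [idS _] := sect_hideal B n.+1 hJ.
have uB : B \in unitmx by rewrite unitmxE unitfE.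
rewrite -lformX -[delta_mx 0 k](mulmxKV uB) mulmx_sum_row linear_sum.
apply: ideal_sum => // r _; rewrite linearZ /= -mul_mpolyC; apply: idealM => //.
have -> : lform (row r B) = row_form B r by rewrite /row_form inord_val.
exact: (mem_sect B hJ (ltn_ord r)).
Qed.

Lemma sectional_matrixP (I : idealr P) i d : hideal (fun f => f \in I) ->
  generic_section_dim I (n.+1 - i) d (sectional_matrix I i d).
Proof.
move=> hI; apply: (epsilon_spec _ (generic_section_dim I (n.+1 - i) d)).
exact: generic_section_dim_exists.
Qed.

Lemma generic_sectional_matrix (I : idealr P) i d : hideal (fun f => f \in I) ->
  exists U : 'M[K]_n.+1 -> Prop, [/\ line_open U, exists B, U B &
    forall B, U B ->
      hf (sect (fun f => f \in I) B (n.+1 - i)) d = sectional_matrix I i d].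
Proof.
move=> hI; have [U [zU [A UA] UP]] := sectional_matrixP i d hI.
exists (fun B => U (top_rows (n.+1 - i) B)); split.
- exact/top_rows_line_open/zariski_open_line_open.
- by have [B BA] := top_rows_surj A (leq_subr i n.+1); exists B; rewrite BA.
move=> B /UP <-; apply: hf_eq => [| |f _]; last exact: iff_sym (section_ideal_sect _ _ _ hI).
  by case: (sect_hideal B (n.+1 - i) hI).
exact: section_ideal_ideal.
Qed.

Hypothesis charK : [pchar K] =i pred0.

Lemma dim_and_multiplicity (I : idealr P) (delta i : nat) :
  homogeneous_ideal I -> generated_in_degree_le I (delta + 1) ->
  (1 <= i <= n.+1)%N -> sectional_matrix I i delta <> 0%N ->
  (forall j, (1 <= j <= n.+1)%N -> sectional_matrix I j delta <> 0%N -> (i <= j)%N) ->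
  sectional_matrix I i delta = sectional_matrix I i (delta + 1) ->
  has_krull_dim {ideal_quot I} (n.+1 - i + 1) /\
  has_multiplicity I (sectional_matrix I i delta).
Proof.
move=> homI genI /andP[i1 iN] m0 imin eqM; rewrite !addn1 in genI eqM *.
have hI : hideal (fun f : P => f \in I).
  by split; [exact: mem_is_ideal | move=> f d; exact: homI].
pose c := (n.+1 - i)%N; have cS : (n.+1 - i.-1 = c.+1)%N by rewrite /c; lia.
set m := sectional_matrix I i delta in m0 eqM *.
have [U1 [oU1 neU1 U1P]] := generic_sectional_matrix i delta hI.
have [U2 [oU2 neU2 U2P]] := generic_sectional_matrix i delta.+1 hI.
have [U3 [oU3 neU3 U3P]] : exists U : 'M[K]_n.+1 -> Prop, [/\ line_open U,
    exists B, U B & forall B, U B -> forall d, delta = d \/ (delta < d)%N ->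
      d = 0%N \/ (forall f, f \is d.-homog -> sect (fun f => f \in I) B c.+1 f)].
  (* For i = 1 no entry of the sectional matrix speaks about D = n + 1 sections;
     independent forms cut out the irrelevant ideal. *)
  have [i_eq1|i_gt1] := eqVneq i 1%N.
    exists (fun B => \det B != 0); split; first exact: det_line_open.
      by exists 1%:M; rewrite det1 oner_eq0.
    move=> B detB d _; have [->|d0] := posnP d; first by left.
    right=> f fd; have cn : c.+1 = n.+1 by rewrite /c i_eq1 subn1.
    rewrite cn; have [idS _] := sect_hideal B n.+1 hI.
    exact: contains_vars_pos idS (invertible_sections_vars hI detB) fd d0.
  have [U [oU neU UP]] := generic_sectional_matrix i.-1 delta hI.
  exists U; split=> // B /UP; rewrite cS => e d dd; right.
  have [idS _] := sect_hideal B c.+1 hI.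
  have z : sectional_matrix I i.-1 delta = 0%N.
    apply: NNPP => nz; have := imin i.-1 _ nz; lia.
  have le : (delta <= d)%N by case: dd => [->|/ltnW].
  rewrite z in e; move/(hf_eq0 _ idS): e => e.
  rewrite -(subnK le); elim: (d - delta)%N => [//|k IH] f /var_decomp[g [gd ->]].
  by apply: ideal_sum => // r _; apply: ideal_mulr => //; apply: IH.
have ne12 := line_open_meet charK oU1 oU2 neU1 neU2.
have ne123 := line_open_meet charK (line_openI oU1 oU2) oU3 ne12 neU3.
have cn : (c <= n)%N by rewrite /c; lia.
have [B [[[U1B U2B] U3B] good]] := choose_sections charK hI
  (line_openI (line_openI oU1 oU2) oU3) ne123 (leqW cn).
have hS := sect_hideal B c hI; have [idS1 _] := sect_hideal B c.+1 hI.
have hfm : forall d, (delta <= d)%N -> hf (sect (fun f => f \in I) B c) d = m.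
  rewrite /m -(U1P B U1B); apply: (persistence (v := row (inord c) B)) => //.
  - by apply: generated_le_sect => //; exact: generated_leI.
  - by case: (U3P B U3B delta.+1) => [|//|]; [right | exact].
  - by apply: (U3P B U3B); left.
  - by rewrite U1P // U2P.
have hf0 d : (delta.+1 <= d)%N -> hf (sect (fun f => f \in I) B c.+1) d = 0%N.
  move=> dd; apply/(hf_eq0 _ idS1).
  by case: (U3P B U3B d) => [|d0|//]; [right | move: dd; rewrite d0].
have dimI : has_krull_dim {ideal_quot I} c.+1.
  apply: (krull_dim_of_sections hI (d0 := delta.+1) (B := B)) => //.
    by move=> r /good[].
  case: (eventually_zero_or_prime hS) => // -[N NP]; case: m0.
  rewrite -(hfm (maxn delta N)) ?leq_maxl //; apply/hf_eq0; first by case: hS.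
  by move=> f; apply: NP; exact: leq_maxr.
split=> //; have [h h1 hs] := series_of_sections hI (fun r rc => (good r rc).1) hfm.
exists c.+1, h; split=> //; rewrite h1; apply/eqP => -[]; exact: m0.
Qed.
End Main.

Theorem theorem5p4 (K : fieldType) (charK : [pchar K] =i pred0) (n : nat)
    (I : idealr {mpoly K[n]}) (delta : nat)
    (homI : homogeneous_ideal I)
    (genI : generated_in_degree_le I (delta + 1))
    (I_delta : ~ (forall f : {mpoly K[n]}, f \is delta.-homog -> f \in I))
    (i : nat) (i_range : (1 <= i <= n)%N)
    (i_nonzero : sectional_matrix I i delta <> 0%N)
    (i_min : forall j : nat, (1 <= j <= n)%N ->
               sectional_matrix I j delta <> 0%N -> (i <= j)%N)
    (eqM : sectional_matrix I i delta = sectional_matrix I i (delta + 1)) :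
  has_krull_dim {ideal_quot I} (n - i + 1) /\
  has_multiplicity I (sectional_matrix I i delta).
Proof.
case: n I homI genI I_delta i_range i_nonzero i_min eqM => [|n] I homI genI _.
  by case/andP; case: (i).
by move=> *; exact: dim_and_multiplicity.
Qed.
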